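(* Let $\{(N_k,B_k)\}_{k=1}^\infty$ be a sequence such that, for all $k\in\mathbb{N}$, $B_k=\{0,1,2,\dots,M_k-1\}$, where $N_k\ge M_k\ge 2$ are integers. Then the infinite convolution $\mu$ of $\{(N_k,B_k)\}_{k=1}^\infty$ is a spectral measure if and only if $M_k\mid N_k$ for all $k\ge 2$.
   Context: $\mathbb{N}=\{1,2,3,\dots\}$. For a finite nonempty set $A\subset\mathbb{R}$, $\delta_A=\frac{1}{\#A}\sum_{a\in A}\delta_a$, where $\delta_a$ is the Dirac measure at $a$ and $\#$ denotes cardinality. For a sequence $\{(N_k,B_k)\}_{k=1}^\infty$, let $\mu_k=\delta_{N_1^{-1}B_1}*\delta_{(N_1N_2)^{-1}B_2}*\cdots*\delta_{(N_1N_2\cdots N_k)^{-1}B_k}$, where $*$ is convolution of measures. The infinite convolution $\mu$ of $\{(N_k,B_k)\}_{k=1}^\infty$ is the weak limit of $\{\mu_k\}$, a Borel probability measure on $\mathbb{R}$ (the limit exists under the hypotheses here). A Borel probability measure $\mu$ on $\mathbb{R}$ is a spectral measure if there is a countable set $\Lambda\subseteq\mathbb{R}$ such that the family $\{e^{-2\pi i\lambda x}:\lambda\in\Lambda\}$ is an orthonormal basis of $L^2(\mu)$. *)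

(* Defs.v *)
From HB Require Import structures.
From mathcomp Require Import all_boot all_order all_algebra finmap.
From mathcomp Require Import complex.
From mathcomp Require Import all_classical all_reals all_analysis.
From mathcomp Require Import measurable_realfun.

Set Implicit Arguments.
Unset Strict Implicit.
Unset Printing Implicit Defensive.
Import Order.TTheory GRing.Theory Num.Theory.
Import numFieldTopology.Exports numFieldNormedType.Exports.

Local Open Scope classical_set_scope.
Local Open Scope complex_scope.
Local Open Scope ring_scope.

Section uniform_measure_on_fset.
Context {R : realType}.
Local Open Scope ereal_scope.

(* [delta_A]; since [0^-1 = 0], this is the zero measure for empty [A]. *)
Definition unif_fset (A : {fset R}) : set (measurableTypeR R) -> \bar R :=
  mscale ((#|` A|%:R : R)^-1%R%:nng)%R
    (msum (fun n => \d_((A : seq R)`_n : measurableTypeR R)) #|` A|).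

Let unif_fset0 A : unif_fset A set0 = 0. Proof. exact: measure0. Qed.

Let unif_fset_ge0 A X : 0 <= unif_fset A X. Proof. exact: measure_ge0. Qed.

Let unif_fset_sigma_additive A : semi_sigma_additive (unif_fset A).
Proof. exact: measure_semi_sigma_additive. Qed.

HB.instance Definition _ A := isMeasure.Build _ _ _ (unif_fset A)
  (unif_fset0 A) (@unif_fset_ge0 A) (@unif_fset_sigma_additive A).

Let unif_fset_fin A : fin_num_fun (unif_fset A).
Proof.
move=> X mX; rewrite /unif_fset /mscale /msum fin_numM//.
by apply/sum_fin_numP => i _ _; exact: fin_num_measure.
Qed.

HB.instance Definition _ A :=
  Measure_isFinite.Build _ _ _ (unif_fset A) (@unif_fset_fin A).

End uniform_measure_on_fset.

Section convolution_of_measures.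
Context {R : realType}.
Local Open Scope ereal_scope.
Local Notation borelR := (measurableTypeR R).

Definition addR (z : borelR * borelR) : borelR := (z.1 + z.2)%R.

Lemma measurable_addR : measurable_fun [set: borelR * borelR] addR.
Proof.
by apply: measurable_funD; [exact: measurable_fst|exact: measurable_snd].
Qed.

HB.instance Definition _ :=
  isMeasurableFun.Build _ _ _ _ addR measurable_addR.

Variables mu nu : {finite_measure set borelR -> \bar R}.

Definition convolution : set borelR -> \bar R := pushforward (mu \x nu) addR.

Let convolution0 : convolution set0 = 0. Proof. exact: measure0. Qed.

Let convolution_ge0 X : 0 <= convolution X. Proof. exact: measure_ge0. Qed.

Let convolution_sigma_additive : semi_sigma_additive convolution.
Proof. exact: measure_semi_sigma_additive. Qed.

HB.instance Definition _ := isMeasure.Build _ _ _ convolution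
  convolution0 convolution_ge0 convolution_sigma_additive.

Let convolution_fin : fin_num_fun convolution.
Proof.
have convT : convolution setT < +oo.
  rewrite /convolution /pushforward preimage_setT -setXTT product_measure1E//.
  by apply: lte_mul_pinfty => //;
    rewrite ?fin_num_measure// ltey_eq fin_num_measure.
move=> X mX; rewrite ge0_fin_numE//; apply: le_lt_trans convT.
by apply: le_measure; rewrite ?inE.
Qed.

HB.instance Definition _ :=
  Measure_isFinite.Build _ _ _ convolution convolution_fin.

End convolution_of_measures.

Section infinite_convolution.
Context {R : realType}.
Local Notation borelR := (measurableTypeR R).
Implicit Types (N : nat -> nat) (B : nat -> {fset R}).

(* [(N_1 ... N_k)^-1 B_k]; the value at index 0 of [N] and [B] is never used. *)
Definition scaled_digits N B k : {fset R} :=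
  [fset (\prod_(1 <= i < k.+1) N i)%N%:R^-1 * b | b in B k]%fset.

(* [mu_k]; [mu_0] is the empty convolution [delta_0], neutral for [*]. *)
Fixpoint conv_seq N B (k : nat) : {finite_measure set borelR -> \bar R} :=
  if k is k'.+1 then
    convolution (conv_seq N B k') (unif_fset (scaled_digits N B k'.+1))
  else dirac (0 : borelR).

Definition cvg_weak (mu_ : nat -> {finite_measure set borelR -> \bar R})
    (mu : probability borelR R) : Prop :=
  forall f : R -> R, continuous f -> [bounded f x | x in [set: R]] ->
    \int[mu_ k]_x f x @[k --> \oo] --> \int[mu]_x f x.

Definition is_infinite_convolution N B (mu : probability borelR R) : Prop :=
  cvg_weak (conv_seq N B) mu.

End infinite_convolution.

Section complex_L2.
Context d (T : measurableType d) (R : realType).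
Variable mu : {measure set T -> \bar R}.
Implicit Types f g : T -> R[i].

Definition normL2 f : \bar R := ('N[mu]_2 [EFin \o (@Normc.normc R \o f)])%E.

Definition inL2 f : Prop :=
  [/\ measurable_fun setT (fun x => complex.Re (f x)),
      measurable_fun setT (fun x => complex.Im (f x)) &
      (normL2 f < +oo)%E].

Definition dotL2 f g : R[i] :=
  (\int[mu]_x complex.Re (f x * (g x)^*))
    +i* (\int[mu]_x complex.Im (f x * (g x)^*)).

(* The family [(e i)_(i in D)] is an orthonormal basis (Hilbert basis) of
   L^2(mu): it is orthonormal and its finite linear combinations are dense. *)
Definition orthonormal_basis (I : choiceType) (D : set I)
    (e : I -> T -> R[i]) : Prop :=
  [/\ forall i, D i -> inL2 (e i),
      forall i j, D i -> D j -> dotL2 (e i) (e j) = (i == j)%:R &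
      forall f, inL2 f -> forall eps : R, 0 < eps ->
        exists (s : {fset I}) (c : I -> R[i]),
          [set` s] `<=` D /\
          (normL2 (fun x => f x - \sum_(i <- s) c i * e i x)%R < eps%:E)%E].

End complex_L2.

Section spectral_measures.
Context {R : realType}.

Definition expi (t : R) : R[i] := cos t +i* sin t.

Definition spectral_measure (mu : probability (measurableTypeR R) R) : Prop :=
  exists2 Lambda : set R, countable Lambda &
    orthonormal_basis mu Lambda
      (fun lambda (x : measurableTypeR R) => expi (- (2 * pi * lambda * x))).

End spectral_measures.

(* Main.v *)
Require Import Defs.
From HB Require Import structures.
From mathcomp Require Import all_boot all_order all_algebra finmap.
From mathcomp Require Import complex ring lra zify.
From mathcomp Require Import all_classical all_reals all_analysis.
From mathcomp Require Import measurable_realfun.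

Set Implicit Arguments.
Unset Strict Implicit.
Unset Printing Implicit Defensive.
Import Order.TTheory GRing.Theory Num.Theory.
Import numFieldTopology.Exports numFieldNormedType.Exports.

Local Open Scope classical_set_scope.
Local Open Scope complex_scope.
Local Open Scope ring_scope.

(** Write [P_k = N_1 ... N_k], [e(t) = exp (2 i pi t)] and [w_M y] for the squared modulus of the
    mean of the [e(j y)], [0 <= j < M].  Then [w_M] is 1-periodic, the values
    [w_M (y + a / M)], [0 <= a < M], sum to 1, and [w_M] vanishes exactly on the fractions
    [z / M] that are not integers.  The squared modulus of the Fourier transform of [mu] at [x]
    is the product over [k >= 1] of the [w_(M_k) (x / P_k)] ([sqn_fourier]).  Let [T_k] be the
    part of this product with indices greater than [k]: the squared modulus of a positive
    definite function with value 1 at 0, so that Bessel's inequality holds for [T_k] at points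
    whose differences are zeros of [T_k] ([bessel_tail_weight]).  Comparing each mask with the
    one of the full digit set [{0, ..., N_k - 1}] makes the product telescope and bounds [T_k]
    below by a positive constant on [|x| <= 2/3 P_k], uniformly in [k] ([tail_weight_lower]).

    If [M_k] divides [N_k] for [k >= 2], finite sets [L_n] are built from [L_0 = {0}] by adding
    to [L_(n-1)] the multiples of [P_n / M_n] and reducing modulo [P_n] to a centered interval.
    They increase, and the identity satisfied by [w_M], together with periodicity, gives
    Parseval's identity at every finite level ([spectrum_parseval]), whence the orthogonality
    of the union of the [L_n].  Since [L_n] is centered, [T_n] is bounded below on any translate
    of it once [n] is large, so that the terms of Parseval's identity at level [n] are dominated
    by those of the Bessel sum for [mu].  Hence Parseval's identity survives in the limit ([spectrum_complete]) and each
    character is approximated by the family; since trigonometric polynomials are dense in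
    L^2 for every probability on the line ([L2_dense]), the family is complete.

    Conversely, translate a spectrum of [mu] so that it avoids the zeros of all factors.  The
    translate satisfies [sum of T_0 = 1]; more generally consider the sets with pairwise
    differences in the zeros of [T_k] and with [T_k] of sum 1 ([tail_spectrum]).  Such a set
    meets each coset of the multiples of [P_(k+1) / M_(k+1)] in points having certain residues
    modulo [P_(k+1)].  Keep one residue per coset, chosen arbitrarily: differences of the
    remaining points are not zeros of the factor of index [k + 1], hence are zeros of
    [T_(k+1)], and Bessel bounds their [T_(k+1)]-mass by 1.  The mass 1 of [T_k] being an average of these
    masses over the choices, all choices give 1.  So every residue occurs, and every choice
    yields a set of the same kind at level [k+1] ([cell_sum_const], [selection_spectrum]).
    Suppose now that [m = M_(k+2)] does not divide [n = N_(k+2)] and make two choices that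
    differ in one coset only, that of a kept point [x0].  At level [k+1] all residues occur, so
    the first choice contains a point [x1] with [x1 - x0] equal to [P_(k+1) n / m] up to a
    multiple of [P_(k+1) n].  As [n / m] is not an integer, [x1] lies in another coset, so the
    second choice contains it too; it must then contain a point that is congruent to [x0] modulo
    [P_(k+1)], which the change of residue excludes ([tail_spectrum_dvd]). *)

(** * Characters of the line *)

Section characters.
Context {R : realType}.
Implicit Types (x y t : R) (z u : R[i]).

(** Real-valued squared modulus; the norm of the complex numbers takes complex values, which
    would have to be projected in every inequality. *)
Definition sqn z : R := complex.Re z ^+ 2 + complex.Im z ^+ 2.

Definition echar x : R[i] := expi (2 * pi * x).

Lemma sqn_ge0 z : 0 <= sqn z.
Proof. by rewrite addr_ge0// sqr_ge0. Qed.

Lemma sqnE z : (sqn z)%:C = z * conjc z.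
Proof. by case: z => a b; rewrite /sqn; simpc; congr (_ +i* _); ring. Qed.

Lemma sqn_sum (I : finType) (f : I -> R[i]) :
  (sqn (\sum_i f i))%:C = \sum_i \sum_j f i * conjc (f j).
Proof.
rewrite sqnE mulr_suml; apply: eq_bigr => i _.
by rewrite rmorph_sum mulr_sumr.
Qed.

Lemma sqnM z u : sqn (z * u) = sqn z * sqn u.
Proof. by case: z => a b; case: u => c d; rewrite /sqn /=; ring. Qed.

Lemma sqn_real x : sqn x%:C = x ^+ 2.
Proof. by rewrite /sqn /= expr0n addr0. Qed.

Lemma sqn_eq0 z : (sqn z == 0) = (z == 0).
Proof.
case: z => a b; rewrite /sqn /= paddr_eq0 ?sqr_ge0// !sqrf_eq0.
by rewrite eq_complex.
Qed.

Lemma expiD x y : expi (x + y) = expi x * expi y :> R[i].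
Proof. by rewrite /expi cosD sinD; simpc; congr (_ +i* _); ring. Qed.

Lemma echarD x y : echar (x + y) = echar x * echar y.
Proof. by rewrite /echar mulrDr expiD. Qed.

Lemma echar0 : echar 0 = 1.
Proof. by rewrite /echar mulr0 /expi cos0 sin0. Qed.

Lemma echarN x : echar (- x) = conjc (echar x).
Proof. by rewrite /echar mulrN /expi cosN sinN. Qed.

Lemma sqn_echar x : sqn (echar x) = 1.
Proof. by rewrite /sqn /= cos2Dsin2. Qed.

Lemma echar_natmul n x : echar (n%:R * x) = echar x ^+ n.
Proof.
elim: n => [|n IH]; first by rewrite mul0r echar0 expr0.
by rewrite -natr1 mulrDl mul1r echarD IH exprSr.
Qed.

Lemma echar_int (k : int) : echar k%:~R = 1.
Proof.
have e1 : echar 1 = 1.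
  by rewrite /echar mulr1 mulrC mulr_natr /expi cos2pi sin2pi.
case: k => n; first by rewrite -[X in echar X]mulr1 echar_natmul e1 expr1n.
by rewrite NegzE mulrNz echarN -[X in echar X]mulr1 echar_natmul e1 expr1n conjc1.
Qed.

(** On the fractional part [f] of [x] the double-angle formula turns [cos (2 pi f) = 1] into
    [sin (pi f) = 0], and [sin] does not vanish on the open interval from 0 to [pi]. *)
Lemma echar_eq1 x : echar x = 1 -> exists k : int, x = k%:~R.
Proof.
move=> ex1; exists (Num.floor x).
set f := x - (Num.floor x)%:~R.
have f0 : 0 <= f by rewrite subr_ge0 floor_le.
have f1 : f < 1 by rewrite ltrBlDl -intrD1 floorD1_gt.
have ef : echar f = 1 by rewrite /f -mulrNz echarD ex1 echar_int mulr1.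
have [f_0|/negP fN0] := boolP (f == 0).
  by apply/eqP; rewrite -subr_eq0.
have sf : 0 < sin (pi * f).
  apply: sin_gt0_pi; rewrite mulr_gt0 ?pi_gt0//= ?lt0r ?f0 ?andbT; last exact/negP.
  by rewrite -[ltRHS]mulr1 ltr_pM2l ?pi_gt0.
have : cos ((pi * f) *+ 2) = 1.
  rewrite (_ : (pi * f) *+ 2 = 2 * pi * f); last by rewrite mulr2n; ring.
  by case: ef.
rewrite cos_mulr2n cos2sin2 => /eqP; rewrite subr_eq.
by have := exprn_gt0 2 sf; lra.
Qed.

End characters.

Arguments echar : simpl never.
Arguments conjc : simpl never.

(** * The mask of a set of consecutive digits *)

Section digit_masks.
Context {R : realType}.
Implicit Types (x y t : R).

Definition digit_mask (M : nat) y : R[i] := M%:R^-1 * \sum_(j < M) echar (j%:R * y).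

Definition weight M y : R := sqn (digit_mask M y).

Lemma weight_ge0 M y : 0 <= weight M y. Proof. exact: sqn_ge0. Qed.

Lemma weightDint M y (k : int) : weight M (y + k%:~R) = weight M y.
Proof.
rewrite /weight /digit_mask; do 2 congr (_ _); apply: eq_bigr => j _.
rewrite mulrDr echarD (_ : j%:R * k%:~R = (j%:Z * k)%:~R); last by rewrite intrM.
by rewrite echar_int mulr1.
Qed.

Lemma echar_sum_roots M (k : int) : (0 < M)%N ->
  \sum_(a < M) echar (k%:~R * (a%:R / M%:R)) =
    (if (M %| `|k|)%N then M%:R else 0) :> R[i].
Proof.
move=> M0; have M0' : (M%:R : R) != 0 by rewrite pnatr_eq0 -lt0n.
set q := echar (k%:~R / M%:R : R).
have -> : \sum_(a < M) echar (k%:~R * (a%:R / M%:R) : R) = \sum_(a < M) q ^+ a.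
  by apply: eq_bigr => a _; rewrite /q -echar_natmul; congr echar; ring.
have qM : q ^+ M = 1.
  by rewrite /q -echar_natmul mulrC divfK// echar_int.
case: ifPn => [|Mk].
  rewrite -[M in (M %| _)%N]absz_nat -dvdzE => /dvdzP[l kE].
  have -> : q = 1 by rewrite /q kE intrM mulfK// echar_int.
  by under eq_bigr do rewrite expr1n; rewrite sumr_const card_ord.
have q1 : q - 1 != 0.
  rewrite subr_eq0; apply/eqP => /echar_eq1[l /eqP].
  rewrite -(inj_eq (mulIf M0')) divfK// => /eqP kE.
  move/negP: Mk; apply; rewrite -[M in (M %| _)%N]absz_nat -dvdzE.
  by apply/dvdzP; exists l; apply/eqP; rewrite -(@eqr_int R) kE intrM.
by apply: (mulfI q1); rewrite -subrX1 qM subrr mulr0.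
Qed.

(** Expanding the squares gives a double sum over pairs of digits; the sum over [a] of the
    [M]-th roots of unity keeps the diagonal only. *)
Lemma sum_weight M y : (0 < M)%N -> \sum_(a < M) weight M (y + a%:R / M%:R) = 1.
Proof.
move=> M0; have M0' : (M%:R : R[i]) != 0 by rewrite pnatr_eq0 -lt0n.
apply: (@complexI R); rewrite rmorph_sum/=.
have E (a : 'I_M) : (weight M (y + a%:R / M%:R))%:C = (M%:R^-1 / M%:R) *
    \sum_(j < M) \sum_(l < M) echar ((j%:R - l%:R) * y) *
      echar ((j%:Z - l%:Z)%:~R * (a%:R / M%:R)) :> R[i].
  rewrite /weight /digit_mask sqnM rmorphM/= sqn_sum; congr (_ * _).
    by rewrite sqnE conjc_inv conjc_nat.
  apply: eq_bigr => j _; apply: eq_bigr => l _.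
  by rewrite -echarN -!echarD intrB; congr echar; ring.
rewrite (eq_bigr _ (fun a _ => E a)).
rewrite -mulr_sumr exchange_big/=.
under eq_bigr => j _.
  rewrite exchange_big/= (bigD1 j)//=.
  rewrite -mulr_sumr echar_sum_roots// !subrr absz0 dvdn0 mul0r echar0 mul1r.
  rewrite big1 ?addr0; last first.
    move=> l lj; rewrite -mulr_sumr echar_sum_roots// ifF ?mulr0//.
    apply/negbTE/negP => /dvdn_leq; rewrite absz_gt0 subr_eq0 eqz_nat.
    rewrite eq_sym => /(_ lj); move: (ltn_ord j) (ltn_ord l).
    lia.
  over.
by rewrite sumr_const card_ord -mulr_natr; field.
Qed.

Lemma weight_le1 M y : (0 < M)%N -> weight M y <= 1.
Proof.
case: M => // M _; rewrite -(@sum_weight M.+1 y)// big_ord_recl/= mul0r addr0.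
by rewrite lerDl sumr_ge0// => i _; exact: weight_ge0.
Qed.

Lemma weight_int M (k : int) : (0 < M)%N -> weight M k%:~R = 1.
Proof.
move=> M0; rewrite /weight /digit_mask (eq_bigr (fun=> 1)) => [|j _].
  by rewrite sumr_const card_ord mulVf ?pnatr_eq0 -?lt0n// /sqn/= expr1n expr0n addr0.
rewrite (_ : j%:R * k%:~R = (j%:Z * k)%:~R); last by rewrite intrM.
by rewrite echar_int.
Qed.

Lemma digit_mask_geometric M y : (0 < M)%N ->
  digit_mask M y * (M%:R * (echar y - 1)) = echar (M%:R * y) - 1.
Proof.
move=> M0; rewrite /digit_mask; under eq_bigr do rewrite echar_natmul.
rewrite echar_natmul subrX1; field.
by rewrite pnatr_eq0 -lt0n.
Qed.

Lemma weight_eq0 M y : (0 < M)%N -> weight M y = 0 ->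
  exists2 k : int, y = k%:~R / M%:R & ~ (M %| `|k|)%N.
Proof.
move=> M0 w0; have M0' : (M%:R : R) != 0 by rewrite pnatr_eq0 -lt0n.
have m0 : digit_mask M y = 0 by apply/eqP; rewrite -sqn_eq0 -/(weight M y) w0.
have := digit_mask_geometric y M0; rewrite m0 mul0r => /esym/eqP.
rewrite subr_eq0 => /eqP/echar_eq1[k kE]; exists k.
  by rewrite -kE mulrC mulKf.
rewrite -[M in (M %| _)%N]absz_nat -dvdzE => /dvdzP[l kl].
have yl : y = l%:~R.
  by apply: (mulfI M0'); rewrite kE kl intrM mulrC.
by move: w0; rewrite yl weight_int// => /eqP; rewrite oner_eq0.
Qed.

Lemma sqn_echarB1 y : sqn (echar y - 1) = (2 * sin (pi * y)) ^+ 2.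
Proof.
rewrite /echar (_ : 2 * pi * y = (pi * y) *+ 2); last by rewrite mulr2n; ring.
rewrite /sqn /= cos_mulr2n sin_mulr2n oppr0 addr0.
have := cos2Dsin2 (pi * y); set c := cos _; set s := sin _ => cs.
have c2 : c ^+ 2 = 1 - s ^+ 2 by rewrite -cs addrK.
rewrite c2 -(mulr_natr (c * s)) -(mulr_natr (1 - s ^+ 2)) 2!exprMn c2; ring.
Qed.

(** The closed form of the mask, without division by the sine. *)
Lemma weight_sin M y : (0 < M)%N ->
  weight M y * (M%:R * sin (pi * y)) ^+ 2 = sin (pi * (M%:R * y)) ^+ 2.
Proof.
move=> M0; have := congr1 sqn (digit_mask_geometric y M0).
rewrite (sqnM (digit_mask M y)) (sqnM M%:R) !sqn_echarB1 -/(weight M y).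
have -> : sqn (M%:R : R[i]) = M%:R ^+ 2 :> R.
  by rewrite -(rmorph_nat (real_complex R)) sqn_real.
by rewrite !exprMn; lra.
Qed.

End digit_masks.

(** * Bounds on the sine *)

Section sine_bounds.
Context {R : realType}.
Implicit Types (x y t s : R).

Lemma sin_MVT t : 0 <= t -> exists2 c : R, 0 <= c <= t & sin t = cos c * t.
Proof.
move=> t0.
have [|c] := @MVT_segment R sin cos 0 t t0.
- exact: (continuous_subspaceT (@continuous_sin R)).
- by rewrite in_itv/= sin0 !subr0 => ct ->; exists c.
Qed.

Lemma sin_sqr_le t : sin t ^+ 2 <= t ^+ 2.
Proof.
wlog t0 : t / 0 <= t.
  move=> H; have [|/ltW t0] := leP 0 t; first exact: H.
  by rewrite -sqrrN -sinN -[leRHS]sqrrN; apply: H; rewrite oppr_ge0.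
have [c _ ->] := sin_MVT t0.
rewrite exprMn ler_piMl ?sqr_ge0// -(cos2Dsin2 c) lerDl sqr_ge0 //.
Qed.

Lemma le_sin_mul_cos s : 0 <= s <= pi / 2 -> s * cos s <= sin s.
Proof.
move=> /andP[s0 s1]; have [c /andP[c0 cs] ->] := sin_MVT s0.
rewrite mulrC ler_wpM2r// .
have pih : pi / 2 <= pi :> R by have := pi_gt0 R; lra.
have [->//|csN] := eqVneq c s.
rewrite ltW// ltr_cos ?in_itv/= ?lt_neqAle ?csN ?cs//.
  by rewrite c0/= (le_trans cs)// (le_trans s1).
by rewrite s0/= (le_trans s1).
Qed.

(** A lower bound for [(sin (pi t) / (pi t)) ^ 2] on [|t| <= 2/3], obtained by halving the angle
    and applying [s * cos s <= sin s] at [s <= pi / 3]. *)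
Definition sinc_const : R := cos (pi / 3) ^+ 4.

Lemma sinc_const_gt0 : 0 < sinc_const.
Proof.
by rewrite exprn_gt0// cos_gt0_pihalf//; have := pi_gt0 R; lra.
Qed.

Lemma sinc_const_le t : `|t| <= 2 / 3 ->
  sinc_const * (pi * t) ^+ 2 <= sin (pi * t) ^+ 2.
Proof.
wlog t0 : t / 0 <= t.
  move=> H; have [|/ltW t0] := leP 0 t; first exact: H.
  have := H (- t); rewrite oppr_ge0 normrN mulrN sinN !sqrrN; exact.
rewrite ger0_norm// => t1; have p0 := pi_gt0 R.
set s := pi * t / 2.
have -> : pi * t = s *+ 2 by rewrite /s mulr2n; field.
have s0 : 0 <= s by rewrite /s divr_ge0// mulr_ge0// ltW.
have s1 : s <= pi / 3.
  have : pi * t <= pi * (2 / 3) by rewrite ler_pM2l.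
  by rewrite /s; lra.
rewrite sin_mulr2n.
have cs : cos (pi / 3) <= cos s.
  have [->//|sN] := eqVneq s (pi / 3).
  by rewrite ltW// ltr_cos ?in_itv/= ?lt_neqAle ?sN ?s1//; apply/andP; split; lra.
have c0 : 0 < cos (pi / 3 : R) by apply: cos_gt0_pihalf; lra.
have := @le_sin_mul_cos s; rewrite s0/= => /(_ _) ss.
have {ss} ss : s * cos s <= sin s by apply: ss; lra.
have h : cos (pi / 3) ^+ 2 * s <= cos s * sin s.
  apply: (@le_trans _ _ (cos s * (s * cos s))); last first.
    by rewrite ler_wpM2l// (le_trans (ltW c0)).
  rewrite (_ : cos s * _ = cos s ^+ 2 * s); last by ring.
  rewrite ler_wpM2r// ler_sqr// nnegrE ?ltW//.
  exact: (lt_le_trans c0).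
have h0 : 0 <= cos (pi / 3) ^+ 2 * s by rewrite mulr_ge0 ?sqr_ge0.
rewrite /sinc_const -[4%N]/(2 * 2)%N exprM -exprMn mulrnAr.
by rewrite ler_sqr ?nnegrE ?mulrn_wge0 ?(le_trans h0)// lerMn2r.
Qed.

(** The sequence [sin (n t)] is concave as long as it is nonnegative, because of the recurrence
    [sin ((n + 2) t) = 2 cos t sin ((n + 1) t) - sin (n t)]; starting from 0, its means decrease. *)
Lemma sin_mul_consecutive (n : nat) t : 0 <= t -> n.+1%:R * t <= pi ->
  n%:R * sin (n.+1%:R * t) <= n.+1%:R * sin (n%:R * t).
Proof.
move=> t0; elim: n => [|n IH] nt; first by rewrite !mul0r sin0 mulr0.
have nt' : n.+1%:R * t <= pi by rewrite (le_trans _ nt)// ler_wpM2r// ler_nat.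
have {IH} := IH nt'.
set a := sin (n%:R * t); set b := sin (n.+1%:R * t); set c := sin (n.+2%:R * t).
have b0 : 0 <= b by rewrite sin_ge0_pi// nt' mulr_ge0.
have cE : c = 2 * cos t * b - a.
  rewrite /c /a /b -2!natr1.
  rewrite (_ : (n%:R + 1 + 1) * t = (n%:R * t + t) + t); last by ring.
  rewrite (_ : (n%:R + 1) * t = n%:R * t + t); last by ring.
  have := cos2Dsin2 t; rewrite !sinD !cosD.
  set u := sin (n%:R * t); set v := cos (n%:R * t).
  set p := sin t; set q := cos t => qp.
  have qp' : u * (q ^+ 2 + p ^+ 2) = u by rewrite qp mulr1.
  by rewrite -[X in _ = _ - X]qp'; ring.
have cb : cos t * b <= b by rewrite ler_piMl// cos_le1.
rewrite -natr1 -(natr1 n.+1) -(natr1 n) => h.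
have n0 : (0 : R) <= n%:R by [].
rewrite cE; nra.
Qed.

Lemma sin_mul_le (m n : nat) t : (m <= n)%N -> 0 <= t -> n%:R * t <= pi ->
  m%:R * sin (n%:R * t) <= n%:R * sin (m%:R * t).
Proof.
move=> + t0; elim: n => [|n IH]; first by rewrite leqn0 => /eqP ->.
rewrite leq_eqVlt => /orP[/eqP -> //|]; rewrite ltnS => mn nt.
have nt' : n%:R * t <= pi by rewrite (le_trans _ nt)// ler_wpM2r// ler_nat.
have {}IH := IH mn nt'.
have S := sin_mul_consecutive t0 nt.
move: mn; rewrite leq_eqVlt => /orP[/eqP -> //|mn].
have n0 : (0 : R) < n%:R by rewrite ltr0n (leq_ltn_trans _ mn).
rewrite -(ler_pM2l n0).
apply: (@le_trans _ _ (m%:R * (n.+1%:R * sin (n%:R * t)))).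
  by rewrite mulrCA ler_wpM2l.
by rewrite mulrCA [leRHS]mulrCA ler_wpM2l.
Qed.

(** The mask of [m <= n] digits dominates the mask of [n] digits near 0: the Fourier transform of
    Lebesgue measure on an interval is thus a minorant of all the products considered here. *)
Lemma sin_sqr_le_weight (m n : nat) y : (0 < m)%N -> (m <= n)%N ->
  `|n%:R * y| <= 1 ->
  sin (pi * (n%:R * y)) ^+ 2 <= weight m y * (n%:R * sin (pi * y)) ^+ 2.
Proof.
move=> m0 mn ny; have m0' : (0 : R) < m%:R by rewrite ltr0n.
suff : (m%:R * sin (pi * (n%:R * y))) ^+ 2 <= (n%:R * sin (pi * (m%:R * y))) ^+ 2.
  rewrite !exprMn -(weight_sin y m0) !exprMn => h.
  rewrite -(ler_pM2l (exprn_gt0 2 m0')) (le_trans h)// le_eqVlt; apply/orP; left.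
  by apply/eqP; ring.
wlog y0 : y ny / 0 <= y.
  move=> H; have [|/ltW y0] := leP 0 y; first exact: H.
  have := H (- y); rewrite !mulrN !normrN oppr_ge0 !sinN !mulrN !sqrrN; exact.
have p0 := pi_gt0 R.
rewrite ger0_norm ?mulr_ge0// in ny.
have npi : n%:R * (pi * y) <= pi.
  by rewrite mulrCA -[leRHS]mulr1 ler_pM2l.
rewrite (mulrCA pi) (mulrCA pi m%:R) ler_sqr ?nnegrE ?mulr_ge0 ?sin_ge0_pi//.
- by apply: sin_mul_le => //; rewrite mulr_ge0// ltW.
- by rewrite npi andbT !mulr_ge0// ltW.
- apply/andP; split; first by rewrite !mulr_ge0// ltW.
  by rewrite (le_trans _ npi)// ler_wpM2r ?ler_nat// mulr_ge0// ltW.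
Qed.

End sine_bounds.

(** * The infinite product and its tails *)

Section infinite_products.
Context {R : realType}.
Variables (N M : nat -> nat).
Hypothesis hNM : forall k, (1 <= k)%N -> (2 <= M k)%N /\ (M k <= N k)%N.
Implicit Types (x y t : R) (n m k K : nat).

Definition scale k : nat := \prod_(1 <= i < k.+1) N i.

Definition partial_mask n K x : R[i] :=
  \prod_(n.+1 <= j < K.+1) digit_mask (M j) (x / (scale j)%:R).

Definition partial_weight n K x : R :=
  \prod_(n.+1 <= j < K.+1) weight (M j) (x / (scale j)%:R).

Definition tail_weight n x : R := limn (fun K => partial_weight n K x).

Lemma digits_gt0 k : (0 < M k.+1)%N.
Proof. by have [/ltnW] := @hNM k.+1 isT. Qed.

Lemma scaleS k : scale k.+1 = (scale k * N k.+1)%N.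
Proof. by rewrite /scale big_nat_recr. Qed.

Lemma scale0 : scale 0 = 1%N. Proof. by rewrite /scale big_geq. Qed.

Lemma scale_ge2exp k : (2 ^ k <= scale k)%N.
Proof.
elim: k => [|k IH]; first by rewrite scale0.
rewrite scaleS expnSr leq_mul//.
by have [M2 MN] := @hNM k.+1 isT; exact: leq_trans MN.
Qed.

Lemma scale_gt0 k : (0 < scale k)%N.
Proof. by rewrite (leq_trans _ (scale_ge2exp k))// expn_gt0. Qed.

Lemma scaleR_gt0 k : 0 < (scale k)%:R :> R.
Proof. by rewrite ltr0n scale_gt0. Qed.

Lemma scaleR_unbounded x : exists k, forall n, (k <= n)%N -> x <= (scale n)%:R.
Proof.
exists (Num.truncn x).+1 => n kn.
rewrite (le_trans (ltW (truncnS_gt x)))// ler_nat (leq_trans kn)//.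
by rewrite (leq_trans _ (scale_ge2exp n))// ltnW// ltn_expl.
Qed.

Lemma sqn_partial_mask n K x : sqn (partial_mask n K x) = partial_weight n K x.
Proof.
rewrite /partial_mask /partial_weight; elim/big_ind2 : _ => //.
- by rewrite /sqn /= expr1n expr0n addr0.
- by move=> z u z' u' <- <-; rewrite sqnM.
Qed.

Lemma partial_maskS n K x : (n <= K)%N ->
  partial_mask n K.+1 x = partial_mask n K x * digit_mask (M K.+1) (x / (scale K.+1)%:R).
Proof. by move=> nK; rewrite /partial_mask big_nat_recr. Qed.

Lemma partial_weightnn n x : partial_weight n n x = 1.
Proof. by rewrite /partial_weight big_geq. Qed.

Lemma partial_masknn n x : partial_mask n n x = 1.
Proof. by rewrite /partial_mask big_geq. Qed.

Lemma partial_weightS n K x : (n <= K)%N ->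
  partial_weight n K.+1 x = partial_weight n K x * weight (M K.+1) (x / (scale K.+1)%:R).
Proof. by move=> nK; rewrite /partial_weight big_nat_recr. Qed.

Lemma partial_weight_cat n m K x : (n <= m)%N -> (m <= K)%N ->
  partial_weight n K x = partial_weight n m x * partial_weight m K x.
Proof. by move=> nm mK; rewrite /partial_weight (@big_cat_nat _ _ _ m.+1). Qed.

Lemma partial_weight_ge0 n K x : 0 <= partial_weight n K x.
Proof. by rewrite -sqn_partial_mask sqn_ge0. Qed.

Lemma partial_weight_le1 n K x : partial_weight n K x <= 1.
Proof.
elim: K => [|K IH]; first by rewrite /partial_weight big_geq.
have [nK|Kn] := leqP n K; last by rewrite /partial_weight big_geq.
rewrite partial_weightS// mulr_ile1// ?partial_weight_ge0 ?weight_ge0//.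
by rewrite weight_le1// digits_gt0.
Qed.

Lemma partial_weight0 n K : partial_weight n K 0 = 1.
Proof.
rewrite /partial_weight big_nat_cond big1// => -[//|j] _.
by rewrite mul0r -(mulr0z 1) (@weight_int R _ 0)// digits_gt0.
Qed.

Lemma nonincreasing_partial_weight n x :
  nonincreasing_seq (fun K => partial_weight n (n + K) x).
Proof.
apply/nonincreasing_seqP => K; rewrite addnS partial_weightS ?leq_addr//.
by rewrite ler_piMr ?partial_weight_ge0// weight_le1// digits_gt0.
Qed.

(** All factors are at most 1, so the partial products decrease. *)
Lemma cvg_partial_weight n x : partial_weight n K x @[K --> \oo] --> tail_weight n x.
Proof.
suff : cvgn (fun K => partial_weight n (n + K)%N x).
  move=> c; apply/cvg_ex; case/cvg_ex : c => l cl; exists l => /=.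
  by rewrite -(cvg_shiftn n); under eq_fun do rewrite addnC.
apply: nonincreasing_is_cvgn; first exact: nonincreasing_partial_weight.
by exists 0 => _ [K _ <-]; exact: partial_weight_ge0.
Qed.

Lemma tail_weight_ge0 n x : 0 <= tail_weight n x.
Proof.
apply: limr_ge; first by apply/cvg_ex; exists (tail_weight n x); exact: cvg_partial_weight.
by apply: nearW => K; exact: partial_weight_ge0.
Qed.

Lemma tail_weight_split n m x : (n <= m)%N ->
  tail_weight n x = partial_weight n m x * tail_weight m x.
Proof.
move=> nm; apply/cvg_lim => //.
have : partial_weight n m x * partial_weight m K x @[K --> \oo] -->
    partial_weight n m x * tail_weight m x.
  by apply: cvgMr; exact: cvg_partial_weight.
apply: cvg_trans; apply: near_eq_cvg; near=> K.
by rewrite -partial_weight_cat//; near: K; exact: nbhs_infty_ge.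
Unshelve. all: by end_near. Qed.

Lemma tail_weightS n x : tail_weight n x =
  weight (M n.+1) (x / (scale n.+1)%:R) * tail_weight n.+1 x.
Proof. by rewrite (@tail_weight_split n n.+1)// partial_weightS// partial_weightnn mul1r. Qed.

Lemma tail_weight0 n : tail_weight n 0 = 1.
Proof.
apply/cvg_lim => //; under eq_fun do rewrite partial_weight0; exact: cvg_cst.
Qed.

(** The right-hand side is what remains after the factors [n + 1, ..., K] of the product for the
    full digit sets have telescoped. *)
Lemma sin_sqr_le_partial_weight n K x : (n <= K)%N -> `|x / (scale n)%:R| <= 1 ->
  ((scale n)%:R * sin (pi * (x / (scale n)%:R))) ^+ 2 <=
  partial_weight n K x * ((scale K)%:R * sin (pi * (x / (scale K)%:R))) ^+ 2.
Proof.
move=> + xn; elim: K => [|K IH].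
  by rewrite leqn0 => /eqP ->; rewrite partial_weightnn mul1r.
rewrite leq_eqVlt => /orP[/eqP ->|]; first by rewrite partial_weightnn mul1r.
rewrite ltnS => nK; rewrite (le_trans (IH nK))// partial_weightS// -mulrA.
rewrite ler_wpM2l ?partial_weight_ge0//.
have [M2 MN] := @hNM K.+1 isT.
have N0 : (N K.+1)%:R != 0 :> R by rewrite pnatr_eq0 -lt0n (leq_trans (digits_gt0 K)).
have sK0 := lt0r_neq0 (scaleR_gt0 K).
set y := x / (scale K.+1)%:R.
have yE : x / (scale K)%:R = (N K.+1)%:R * y.
  by rewrite /y scaleS natrM; field; rewrite N0 sK0.
rewrite yE scaleS natrM exprMn -mulrA (exprMn _ (scale K)%:R) (mulrCA (weight _ _)).
rewrite ler_wpM2l ?sqr_ge0// sin_sqr_le_weight//; first exact: digits_gt0.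
rewrite -yE (le_trans _ xn)// !normrM ler_wpM2l// !normfV.
rewrite !ger0_norm// lef_pV2 ?posrE ?scaleR_gt0// ler_nat.
rewrite -(subnKC nK); elim: (K - n)%N => [|j]; first by rewrite addn0.
move=> /leq_trans; apply; rewrite addnS scaleS leq_pmulr//.
by have [] := @hNM (n + j).+1 isT; move=> h /(leq_trans h)/ltnW.
Qed.

(** The bound does not depend on [n]: at scale [scale n] all the tails look like convolutions
    carried by the unit interval. *)
Lemma tail_weight_lower n x : `|x / (scale n)%:R| <= 2 / 3 ->
  sinc_const <= tail_weight n x.
Proof.
move=> xn; have [->|x0] := eqVneq x 0.
  rewrite tail_weight0 exprn_ile1 ?cos_le1//.
  by apply: cos_ge0_pihalf; have := pi_gt0 R; lra.
have sn0 := scaleR_gt0 n.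
apply: limr_ge; first by apply/cvg_ex; exists (tail_weight n x); exact: cvg_partial_weight.
near=> K; have nK : (n <= K)%N by near: K; exact: nbhs_infty_ge.
set y := x / (scale n)%:R; have y0 : 0 < (pi * y) ^+ 2.
  rewrite lt0r sqr_ge0 andbT sqrf_eq0 mulf_neq0 ?(lt0r_neq0 (pi_gt0 R))//.
  by rewrite mulf_neq0// invr_neq0// lt0r_neq0.
rewrite -(ler_pM2r y0) (le_trans (sinc_const_le xn))//.
rewrite -(ler_pM2l (exprn_gt0 2 sn0)) -exprMn.
have yn1 : `|x / (scale n)%:R| <= 1 by rewrite (le_trans xn)//; lra.
rewrite (le_trans (sin_sqr_le_partial_weight nK yn1))// [leRHS]mulrCA.
rewrite ler_wpM2l ?partial_weight_ge0//.
rewrite -exprMn (_ : (scale n)%:R * (pi * y) = pi * x); last first.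
  by rewrite /y; field; rewrite lt0r_neq0.
have sK0 := scaleR_gt0 K.
rewrite exprMn (_ : pi * x = (scale K)%:R * (pi * (x / (scale K)%:R))); last first.
  by field; rewrite lt0r_neq0.
by rewrite exprMn ler_wpM2l ?sqr_ge0// sin_sqr_le.
Unshelve. all: by end_near. Qed.

End infinite_products.

(** * Positive definiteness and the Bessel inequality *)

Section bessel.
Context {R : realType}.
Implicit Types (phi : R -> R[i]) (x y t : R).


Lemma conjcM (z u : R[i]) : conjc (z * u) = conjc z * conjc u.
Proof. exact: rmorphM. Qed.

Lemma sqnJ (z : R[i]) : sqn (conjc z) = sqn z.
Proof. by case: z => a b; rewrite /sqn /= sqrrN. Qed.

Lemma complex_ReD (z u : R[i]) : complex.Re (z + u) = complex.Re z + complex.Re u.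
Proof. by case: z => ? ?; case: u => ? ?. Qed.

Lemma complex_ImD (z u : R[i]) : complex.Im (z + u) = complex.Im z + complex.Im u.
Proof. by case: z => ? ?; case: u => ? ?. Qed.

Lemma complex_ReN (z : R[i]) : complex.Re (- z) = - complex.Re z.
Proof. by case: z. Qed.

Lemma complex_Re_sum (I : Type) (s : seq I) (P : pred I) (f : I -> R[i]) :
  complex.Re (\sum_(i <- s | P i) f i) = \sum_(i <- s | P i) complex.Re (f i).
Proof. exact: (big_morph _ complex_ReD). Qed.

Lemma complex_Im_sum (I : Type) (s : seq I) (P : pred I) (f : I -> R[i]) :
  complex.Im (\sum_(i <- s | P i) f i) = \sum_(i <- s | P i) complex.Im (f i).
Proof. exact: (big_morph _ complex_ImD). Qed.

Lemma Re_le_sqrt_sqn (z : R[i]) : complex.Re z <= Num.sqrt (sqn z).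
Proof.
rewrite (le_trans (ler_norm _))// -sqrtr_sqr ler_sqrt ?sqn_ge0//.
by rewrite lerDl sqr_ge0.
Qed.

Definition positive_definite phi := forall r (c : nat -> R[i]) (x : nat -> R),
  0 <= \sum_(i < r) \sum_(j < r) c i * conjc (c j) * phi (x i - x j).

Lemma posdef1 : positive_definite (fun=> 1).
Proof.
move=> r c x; rewrite (_ : \sum_(i < r) _ = (sqn (\sum_(i < r) c i))%:C).
  by rewrite ler0c sqn_ge0.
by rewrite sqn_sum; do 2 (apply: eq_bigr => ? _); rewrite mulr1.
Qed.

(** A character is absorbed into the coefficients, and a mask is an average of characters. *)
Lemma posdefM_digit_mask phi m t : positive_definite phi ->
  positive_definite (fun x => phi x * digit_mask m (x / t)).
Proof.
move=> pphi r c x.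
pose d (a : 'I_m) k := c k * echar (a%:R / t * x k).
rewrite (_ : \sum_(i < r) _ = m%:R^-1 * \sum_(a < m) \sum_(i < r) \sum_(j < r)
    d a i * conjc (d a j) * phi (x i - x j)).
  by rewrite mulr_ge0// ?invr_ge0 ?ler0n// sumr_ge0.
rewrite mulr_sumr; under [RHS]eq_bigr do rewrite mulr_sumr.
rewrite [RHS]exchange_big; apply: eq_bigr => i _/=.
under [RHS]eq_bigr do rewrite mulr_sumr.
rewrite [RHS]exchange_big; apply: eq_bigr => j _/=.
rewrite /digit_mask !mulr_sumr; apply: eq_bigr => a _.
rewrite /d conjcM -echarN.
rewrite (_ : a%:R * ((x i - x j) / t) = a%:R / t * x i - a%:R / t * x j); last by ring.
rewrite echarD; ring.
Qed.

(** Positivity of the form at the points [0, x_0, ..., x_(r-1)] with the coefficients [1] and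
    [- phi (- x_i)] that the projection of the first vector on the others would have.  When the
    family is orthogonal the error term on the right vanishes; it is kept because the finite
    products are only asymptotically orthogonal. *)
Lemma posdef_bessel phi r (x : nat -> R) : positive_definite phi ->
  phi 0 = 1 -> (forall y, phi (- y) = conjc (phi y)) ->
  (forall y, sqn (phi y) <= 1) ->
  \sum_(i < r) sqn (phi (x i)) <=
    1 + \sum_(i < r) \sum_(j < r | j != i) Num.sqrt (sqn (phi (x i - x j))).
Proof.
move=> pphi phi0 phiN phi1.
(* index 0 stands for the projected vector, index [i + 1] for the [i]-th point *)
pose c k := if k is k'.+1 then - conjc (phi (x k')) else 1 : R[i].
pose z k := if k is k'.+1 then x k' else 0 : R.
have := pphi r.+1 c z.
rewrite big_ord_recl/= big_ord_recl/= conjc1 subrr phi0 !mulr1.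
have -> : \sum_(i < r) 1 * conjc (- conjc (phi (x i))) * phi (0 - x i) =
    - (\sum_(i < r) sqn (phi (x i)))%:C.
  rewrite rmorph_sum/= -sumrN; apply: eq_bigr => i _.
  by rewrite rmorphN/= conjcK mul1r sub0r phiN mulNr -sqnE.
have -> : \sum_(i < r) \sum_(j < r.+1) c i.+1 * conjc (c j) * phi (x i - z j) =
    - (\sum_(i < r) sqn (phi (x i)))%:C + (\sum_(i < r) sqn (phi (x i)))%:C +
    \sum_(i < r) \sum_(j < r | j != i)
       conjc (phi (x i)) * phi (x j) * phi (x i - x j).
  rewrite !rmorph_sum/= -sumrN -!big_split/=; apply: eq_bigr => i _.
  rewrite big_ord_recl/= conjc1 mulr1 subr0 (bigD1 i)//= subrr phi0 mulr1.
  rewrite -addrA; congr (_ + _); first by rewrite mulNr mulrC -sqnE.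
  congr (_ + _); first by rewrite rmorphN/= conjcK mulrNN mulrC -sqnE.
  by apply: eq_bigr => j _; rewrite rmorphN/= conjcK mulrNN.
rewrite addNr add0r lecE => /andP[_].
set S := \sum_(i < r) sqn _.
rewrite !complex_ReD complex_ReN !complex_Re_sum.
rewrite [complex.Re 1]/= [complex.Re S%:C]/= [complex.Re 0]/= => H.
rewrite -subr_ge0 addrAC (le_trans H)// lerD2l ler_sum// => i _.
rewrite complex_Re_sum ler_sum// => j _; rewrite (le_trans (Re_le_sqrt_sqn _))//.
rewrite ler_sqrt ?sqn_ge0// !sqnM sqnJ.
by rewrite ler_piMl ?sqn_ge0// mulr_ile1// sqn_ge0.
Qed.

Variables (N M : nat -> nat).
Hypothesis hNM : forall k, (1 <= k)%N -> (2 <= M k)%N /\ (M k <= N k)%N.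

Lemma posdef_partial_mask n K : positive_definite (partial_mask (R := R) N M n K).
Proof.
have [|nK] := leqP K n.
  move=> Kn; rewrite (_ : partial_mask _ _ _ _ = fun=> 1); first exact: posdef1.
  by apply/funext => x; rewrite /partial_mask big_geq.
elim: K nK => // K IH; rewrite ltnS leq_eqVlt => /orP[/eqP ->|nK].
  rewrite (_ : partial_mask _ _ _ _ =
     fun x => 1 * digit_mask (M K.+1) (x / (scale N K.+1)%:R)).
    exact: posdefM_digit_mask posdef1.
  by apply/funext => x; rewrite partial_maskS// partial_masknn.
rewrite (_ : partial_mask _ _ _ _ =
   fun x => partial_mask N M n K x * digit_mask (M K.+1) (x / (scale N K.+1)%:R)).
  exact: posdefM_digit_mask (IH nK).
by apply/funext => x; rewrite partial_maskS// ltnW.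
Qed.

Lemma partial_maskN n K (x : R) : partial_mask N M n K (- x) = conjc (partial_mask N M n K x).
Proof.
rewrite /partial_mask rmorph_prod; apply: eq_bigr => j _.
rewrite /digit_mask rmorphM rmorph_sum/= conjc_inv conjc_nat.
by congr (_ * _); apply: eq_bigr => a _; rewrite -echarN mulNr mulrN.
Qed.

Lemma partial_mask0 n K : partial_mask N M n K (0 : R) = 1.
Proof.
rewrite /partial_mask big_nat_cond big1// => -[//|j] _.
rewrite mul0r /digit_mask; under eq_bigr do rewrite mulr0 echar0.
by rewrite sumr_const card_ord mulVf// pnatr_eq0 -lt0n (digits_gt0 hNM).
Qed.

(** The tails are not given as transforms of measures, but their finite sections are positive
    definite, and the error term of [posdef_bessel] tends to 0. *)
Lemma bessel_tail_weight n (s : seq R) : uniq s ->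
  {in s &, forall x y, x != y -> tail_weight N M n (x - y) = 0} ->
  \sum_(x <- s) tail_weight N M n x <= 1.
Proof.
move=> us os; rewrite (big_nth 0) big_mkord.
pose x k := s`_k; pose r := size s.
have cL : (\sum_(i < r) partial_weight N M n K (x i)) @[K --> \oo] -->
          \sum_(i < r) tail_weight N M n (x i).
  apply: cvg_big => [|i _]; first exact: add_continuous.
  exact: (cvg_partial_weight hNM).
have cR : (1 + \sum_(i < r) \sum_(j < r | j != i)
    Num.sqrt (partial_weight N M n K (x i - x j))) @[K --> \oo] --> (1 + 0 : R).
  apply: cvgD; first exact: cvg_cst.
  rewrite [X in _ --> X](_ : 0 = \sum_(i < r) \sum_(j < r | j != i) 0); last first.
    by rewrite big1// => i _; rewrite big1.
  apply: cvg_big => [|i _]; first exact: add_continuous.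
  apply: cvg_big => [|j ij]; first exact: add_continuous.
  rewrite -[X in _ --> X]sqrtr0.
  apply: (@cvg_comp _ _ _ _ (@Num.sqrt R)); last exact: sqrt_continuous.
  have -> : 0 = tail_weight N M n (x i - x j).
    by rewrite os ?mem_nth// nth_uniq// eq_sym.
  exact: (cvg_partial_weight hNM).
rewrite -[leRHS]addr0; apply: ler_cvg_to cL cR _; apply: nearW => K.
under eq_bigr do rewrite -sqn_partial_mask.
under [X in _ <= 1 + X]eq_bigr do under eq_bigr do rewrite -sqn_partial_mask.
apply: (@posdef_bessel _ _ x (@posdef_partial_mask n K)
  (partial_mask0 n K) (partial_maskN n K)) => y.
by rewrite sqn_partial_mask partial_weight_le1.
Qed.

End bessel.

(** * The Fourier transform of the infinite convolution *)

Section fourier_transform.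
Context {R : realType}.
Local Notation borelR := (measurableTypeR R).
Implicit Types (x y t xi : R) (A : {fset R}).
Implicit Types mu : {finite_measure set borelR -> \bar R}.

(** Tonelli reduces the convolution with a uniform measure to a mean of translates. *)
Lemma ge0_integral_conv_unif mu A (f : borelR -> \bar R) :
  measurable_fun setT f -> (forall x, 0 <= f x)%E ->
  (\int[convolution mu (unif_fset A)]_x f x =
   ((#|` A|%:R)^-1)%:E * \sum_(a <- A) \int[mu]_x f (x + a)%R)%E.
Proof.
move=> mf f0; rewrite ge0_integral_pushforward//=.
rewrite preimage_setT fubini_tonelli2//; last first.
  by apply: measurableT_comp => //; exact: measurable_addR.
have mG : measurable_fun setT (fun y : borelR => \int[mu]_x f (x + y)%R)%E.
  apply: (measurable_fun_fubini_tonelli_G (fun z : borelR * borelR => f (z.1 + z.2))).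
    by apply: (measurableT_comp mf); exact: measurable_addR.
  by move=> z; exact: f0.
have G0 (y : borelR) : (0 <= \int[mu]_x f (x + y)%R)%E by exact: integral_ge0.
rewrite [LHS](ge0_integral_mscale _ measurableT _ mG (fun x _ => G0 x)).
congr (_ * _)%E.
transitivity (\sum_(i < #|` A|)
    \int[\d_((A : seq R)`_i : borelR)]_y \int[mu]_x f (x + y)%R)%E.
  have E := @ge0_integral_measure_sum _ borelR R
    (fun n => \d_((A : seq R)`_n : borelR)) _ measurableT _
    (fun x _ => G0 x) mG #|` A|.
  exact: E.
rewrite [RHS](big_nth 0) big_mkord; apply: eq_bigr => i _.
by rewrite integral_dirac// diracT mul1e.
Qed.

Lemma integrable_bounded mu (f : borelR -> R) (b : R) :
  measurable_fun setT f -> (forall x, `|f x| <= b) -> mu.-integrable setT (EFin \o f).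
Proof.
move=> mf fb; apply: measurable_bounded_integrable => //.
  by rewrite ltey_eq fin_num_measure.
by exists b; split => [|r br x _]; [exact: num_real|exact: le_trans (fb x) (ltW br)].
Qed.

Lemma measurable_shift (f : borelR -> R) a :
  measurable_fun setT f -> measurable_fun setT (fun x : borelR => f (x + a)).
Proof.
move=> mf; apply: (measurableT_comp mf).
by apply: measurable_funD => //; exact: measurable_id.
Qed.

(** The nonnegative case is applied to [1 + f] and to [1]. *)
Lemma integral_conv_unif mu A (f : borelR -> R) :
  measurable_fun setT f -> (forall x, `|f x| <= 1) ->
  \int[convolution mu (unif_fset A)]_x f x =
   (#|` A|%:R)^-1 * \sum_(a <- A) \int[mu]_x f (x + a).
Proof.
move=> mf f1.
have ge0 (g : borelR -> R) :
    measurable_fun setT g -> (forall x, `|g x| <= 2) -> (forall x, 0 <= g x) ->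
    \int[convolution mu (unif_fset A)]_x g x =
      (#|` A|%:R)^-1 * \sum_(a <- A) \int[mu]_x g (x + a).
  move=> mg g2 g0; rewrite /Rintegral ge0_integral_conv_unif//; last first.
    exact/measurable_EFinP.
  rewrite (eq_bigr (fun a => (\int[mu]_x g (x + a))%:E)).
    by rewrite sumEFin -EFinM.
  move=> a _; rewrite fineK//; apply: integrable_fin_num => //.
  by apply: (@integrable_bounded _ _ 2) => //; exact: measurable_shift.
have mf1 : measurable_fun setT (fun x : borelR => 1 + f x).
  by apply: measurable_funD.
have I1 (nu : {finite_measure set borelR -> \bar R}) :
    nu.-integrable setT (EFin \o (fun=> 1 : R) : borelR -> \bar R).
  by apply: (@integrable_bounded nu _ 1) => // x; rewrite normr1.
have If (nu : {finite_measure set borelR -> \bar R}) :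
    nu.-integrable setT (EFin \o f) by exact: (@integrable_bounded nu _ 1).
have := ge0 (fun x => 1 + f x) mf1.
rewrite (RintegralD measurableT (I1 _) (If _)).
have h1 x : `|1 + f x| <= 2.
  by rewrite (le_trans (ler_normD _ _))// normr1 -[2]/(1 + 1) lerD2l.
have h2 x : 0 <= 1 + f x.
  by have := f1 x; rewrite ler_norml => /andP[]; lra.
move=> /(_ h1 h2).
have -> : \sum_(a <- A) \int[mu]_x (1 + f (x + a)) =
    \sum_(a <- A) \int[mu]_x (1 : R) + \sum_(a <- A) \int[mu]_x f (x + a).
  rewrite -big_split/=; apply: eq_bigr => a _.
  have If' : mu.-integrable setT (EFin \o (fun x : borelR => f (x + a))).
    by apply: (@integrable_bounded mu _ 1) => //; exact: measurable_shift.
  by rewrite (RintegralD measurableT (I1 mu) If').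
have := ge0 (fun=> 1) (measurable_cst _) (fun=> _) (fun=> ler01).
rewrite normr1 ler1n => /(_ (fun=> isT)) ->.
by rewrite mulrDr => /addrI.
Qed.

Definition fourier mu xi : R[i] :=
  (\int[mu]_t complex.Re (echar (xi * t))) +i*
  (\int[mu]_t complex.Im (echar (xi * t))).

Lemma continuous_Re_echar xi : continuous (fun t : R => complex.Re (echar (xi * t))).
Proof.
move=> t; apply: (@cvg_comp _ _ _ (fun t => 2 * pi * (xi * t)) (@cos R));
  last exact: continuous_cos.
by apply: cvgMr; apply: cvgMr; exact: cvg_id.
Qed.

Lemma continuous_Im_echar xi : continuous (fun t : R => complex.Im (echar (xi * t))).
Proof.
move=> t; apply: (@cvg_comp _ _ _ (fun t => 2 * pi * (xi * t)) (@sin R));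
  last exact: continuous_sin.
by apply: cvgMr; apply: cvgMr; exact: cvg_id.
Qed.

Lemma measurable_Re_echar xi :
  measurable_fun setT (fun t : borelR => complex.Re (echar (xi * t))).
Proof. apply: continuous_measurable_fun; exact: continuous_Re_echar. Qed.

Lemma measurable_Im_echar xi :
  measurable_fun setT (fun t : borelR => complex.Im (echar (xi * t))).
Proof. apply: continuous_measurable_fun; exact: continuous_Im_echar. Qed.

Lemma complex_ReM (z u : R[i]) :
  complex.Re (z * u) = complex.Re z * complex.Re u - complex.Im z * complex.Im u.
Proof. by case: z => ? ?; case: u. Qed.

Lemma complex_ImM (z u : R[i]) :
  complex.Im (z * u) = complex.Re z * complex.Im u + complex.Im z * complex.Re u.
Proof. by case: z => ? ?; case: u. Qed.

Lemma Re_echar_le1 x : `|complex.Re (echar x)| <= 1 :> R.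
Proof. exact: cos_max. Qed.

Lemma Im_echar_le1 x : `|complex.Im (echar x)| <= 1 :> R.
Proof. exact: sin_max. Qed.

Lemma fourier_conv_unif mu A xi :
  fourier (convolution mu (unif_fset A)) xi =
  fourier mu xi * ((#|` A|%:R)^-1 * \sum_(a <- A) echar (xi * a)).
Proof.
have IR : mu.-integrable setT (EFin \o (fun t : borelR => complex.Re (echar (xi * t)))).
  apply: (@integrable_bounded _ _ 1); first exact: measurable_Re_echar.
  by move=> x; exact: Re_echar_le1.
have II : mu.-integrable setT (EFin \o (fun t : borelR => complex.Im (echar (xi * t)))).
  apply: (@integrable_bounded _ _ 1); first exact: measurable_Im_echar.
  by move=> x; exact: Im_echar_le1.
rewrite {1}/fourier !integral_conv_unif; last 4 first.
- exact: measurable_Im_echar.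
- by move=> x; exact: Im_echar_le1.
- exact: measurable_Re_echar.
- by move=> x; exact: Re_echar_le1.
have Ic (f : borelR -> R) c : mu.-integrable setT (EFin \o f) ->
    mu.-integrable setT (EFin \o (fun t => f t * c)).
  by move=> h; exact: (integrableZr measurableT c h).
have ER a : \int[mu]_t complex.Re (echar (xi * (t + a))) =
    complex.Re (fourier mu xi * echar (xi * a)).
  under eq_Rintegral => t _ do rewrite mulrDr echarD complex_ReM.
  by rewrite (RintegralB measurableT (Ic _ _ IR) (Ic _ _ II)) !RintegralZr// complex_ReM.
have EI a : \int[mu]_t complex.Im (echar (xi * (t + a))) =
    complex.Im (fourier mu xi * echar (xi * a)).
  under eq_Rintegral => t _ do rewrite mulrDr echarD complex_ImM.
  by rewrite (RintegralD measurableT (Ic _ _ IR) (Ic _ _ II)) !RintegralZr// complex_ImM.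
rewrite (eq_bigr _ (fun a _ => ER a)) (eq_bigr _ (fun a _ => EI a)).
rewrite -complex_Re_sum -complex_Im_sum -mulr_sumr mulrCA.
rewrite (_ : (#|` A|%:R)^-1 = ((#|` A|%:R)^-1)%:C :> R[i]).
  by case: (fourier mu xi * _) => a b; simpc.
by rewrite fmorphV rmorph_nat.
Qed.

Variables (N M : nat -> nat) (B : nat -> {fset R}).
Hypothesis hNM : forall k, (1 <= k)%N -> (2 <= M k)%N /\ (M k <= N k)%N.
Hypothesis hB : forall k, (1 <= k)%N -> B k = [fset j%:R | j in iota 0 (M k)]%fset.

Lemma sum_scaled_digits k (f : R -> R[i]) :
  let A := scaled_digits N B k.+1 in
  (#|` A|%:R)^-1 * \sum_(a <- A) f a =
  (M k.+1)%:R^-1 * \sum_(j < M k.+1) f ((scale N k.+1)%:R^-1 * j%:R).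
Proof.
move=> A.
pose s := [seq (scale N k.+1)%:R^-1 * j%:R | j <- iota 0 (M k.+1)] : seq R.
have p : perm_eq A s.
  apply: uniq_perm; first exact: fset_uniq.
    rewrite map_inj_uniq ?iota_uniq// => i j /(mulfI _) ij.
    by apply/eqP; rewrite -(@eqr_nat R) ij// invr_neq0// lt0r_neq0// (scaleR_gt0 hNM).
  move=> x; apply/imfsetP/mapP => /= -[j]; rewrite hB//.
    by move=> /imfsetP[/= i iM ->] ->; exists i.
  by move=> jM ->; exists j%:R => //; apply/imfsetP; exists j.
rewrite (perm_big _ p) (perm_size p) size_map size_iota big_map -[M k.+1]subn0.
by rewrite -/(index_iota 0 (M k.+1)) big_mkord subn0.
Qed.

Lemma fourier_conv_seq k xi : fourier (conv_seq N B k) xi = partial_mask N M 0 k xi.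
Proof.
elim: k => [|k IH] /=.
  rewrite partial_masknn /fourier /Rintegral !integral_dirac// ?diracT ?mul1e; last 2 first.
  - by apply/measurable_EFinP; exact: measurable_Im_echar.
  - by apply/measurable_EFinP; exact: measurable_Re_echar.
  by rewrite /= !mulr0 cos0 sin0.
rewrite fourier_conv_unif IH sum_scaled_digits partial_maskS//; congr (_ * (_ * _)).
by apply: eq_bigr => j _; congr echar; ring.
Qed.

Variable mu : probability borelR R.
Hypothesis hmu : is_infinite_convolution N B mu.

Lemma cvg_fourier_Re xi :
  complex.Re (partial_mask N M 0 k xi) @[k --> \oo] --> complex.Re (fourier mu xi).
Proof.
under eq_fun do rewrite -fourier_conv_seq.
apply: hmu; first exact: continuous_Re_echar.
by exists 1; split => [|r r1 x _]; [exact: num_real|exact: le_trans (Re_echar_le1 _) (ltW r1)].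
Qed.

Lemma cvg_fourier_Im xi :
  complex.Im (partial_mask N M 0 k xi) @[k --> \oo] --> complex.Im (fourier mu xi).
Proof.
under eq_fun do rewrite -fourier_conv_seq.
apply: hmu; first exact: continuous_Im_echar.
by exists 1; split => [|r r1 x _]; [exact: num_real|exact: le_trans (Im_echar_le1 _) (ltW r1)].
Qed.

(** Characters are bounded and continuous, so weak convergence passes to the transforms. *)
Lemma sqn_fourier xi : sqn (fourier mu xi) = tail_weight N M 0 xi.
Proof.
apply/esym/cvg_lim => //; under eq_fun do rewrite -sqn_partial_mask /sqn !expr2.
by rewrite /sqn !expr2; apply: cvgD; apply: cvgM;
  [exact: cvg_fourier_Re..|exact: cvg_fourier_Im|exact: cvg_fourier_Im].
Qed.

End fourier_transform.

(** * The square norm of trigonometric sums *)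

Section energy.
Context {R : realType}.
Local Notation borelR := (measurableTypeR R).
Variable mu : probability borelR R.
Implicit Types (f g : borelR -> R[i]) (x y t xi : R).

(** The square of the L^2 norm, as an extended real: it avoids roots, at the price of a factor 2
    in the triangle inequality. *)
Definition energy f : \bar R := (\int[mu]_x (sqn (f x))%:E)%E.

Lemma normL2_sqr f : (normL2 mu f `^ 2)%E = energy f.
Proof.
rewrite /normL2 poweR_Lnorm// /energy; apply: eq_integral => x _ /=.
rewrite powR_mulrn ?normr_ge0// -normrX.
congr EFin; rewrite /sqn; case: (f x) => a b /=.
by rewrite sqr_sqrtr ?addr_ge0 ?sqr_ge0// ger0_norm// addr_ge0 ?sqr_ge0.
Qed.

Lemma normL2_lt f (eps : R) : 0 < eps ->
  (normL2 mu f < eps%:E)%E = (energy f < (eps ^+ 2)%:E)%E.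
Proof.
move=> e0; rewrite -normL2_sqr.
have := Lnorm_ge0 mu 2%:E (EFin \o (@Normc.normc R \o f)).
rewrite -/(normL2 mu f); case: (normL2 mu f) => [r|_|]//.
  rewrite lee_fin => r0; rewrite poweR_EFin powR_mulrn// !lte_fin.
  by rewrite ltr_sqr ?nnegrE// ltW.
by rewrite poweRyr// ?gt_eqF// !ltNge !leey.
Qed.

Lemma normL2_lty f : (normL2 mu f < +oo)%E = (energy f < +oo)%E.
Proof.
rewrite -normL2_sqr.
have := Lnorm_ge0 mu 2%:E (EFin \o (@Normc.normc R \o f)).
rewrite -/(normL2 mu f); case: (normL2 mu f) => [r|_|]//.
  by move=> _; rewrite poweR_EFin !ltry.
by rewrite poweRyr// ?gt_eqF.
Qed.

Lemma fourierN xi : fourier mu (- xi) = conjc (fourier mu xi).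
Proof.
rewrite /fourier; congr (_ +i* _).
  by apply: eq_Rintegral => t _; rewrite mulNr echarN; case: (echar _).
rewrite -[RHS]mulN1r -RintegralZl//; last first.
  apply: (@integrable_bounded _ _ _ 1) => [|x]; first exact: measurable_Im_echar.
  exact: Im_echar_le1.
by apply: eq_Rintegral => t _; rewrite mulNr echarN mulN1r; case: (echar _).
Qed.

Lemma fourier0 : fourier mu 0 = 1.
Proof.
rewrite /fourier; under eq_Rintegral do rewrite mul0r echar0/=.
under [X in _ +i* X]eq_Rintegral do rewrite mul0r echar0/=.
rewrite (Rintegral_cst mu measurableT 1) (Rintegral_cst mu measurableT 0).
have m1 : fine (mu [set: borelR]) = 1 by rewrite (@probability_setT _ _ _ mu).
apply: (etrans (congr2 (fun a b => (1 * a) +i* (0 * b)) m1 m1)).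
by rewrite mulr1 mul0r.
Qed.

Lemma integral_Re_echarM (a : R[i]) xi :
  mu.-integrable setT (EFin \o (fun t : borelR => complex.Re (a * echar (xi * t)))) /\
  \int[mu]_t complex.Re (a * echar (xi * t)) = complex.Re (a * fourier mu xi).
Proof.
have IR : mu.-integrable setT (EFin \o (fun t : borelR => complex.Re (echar (xi * t)))).
  apply: (@integrable_bounded _ _ _ 1); first exact: measurable_Re_echar.
  by move=> x; exact: Re_echar_le1.
have II : mu.-integrable setT (EFin \o (fun t : borelR => complex.Im (echar (xi * t)))).
  apply: (@integrable_bounded _ _ _ 1); first exact: measurable_Im_echar.
  by move=> x; exact: Im_echar_le1.
have Ic (f : borelR -> R) c : mu.-integrable setT (EFin \o f) ->
    mu.-integrable setT (EFin \o (fun t => c * f t)).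
  by move=> h; exact: (integrableZl measurableT c h).
have E t : complex.Re (a * echar (xi * t)) =
   complex.Re a * complex.Re (echar (xi * t)) - complex.Im a * complex.Im (echar (xi * t)).
  exact: complex_ReM.
split.
  under eq_fun do rewrite E.
  exact: (integrableB measurableT (Ic _ _ IR) (Ic _ _ II)).
under eq_Rintegral do rewrite E.
by rewrite (RintegralB measurableT (Ic _ _ IR) (Ic _ _ II)) !RintegralZl// complex_ReM.
Qed.

Lemma energy_trig r (a : nat -> R[i]) (x : nat -> R) :
  energy (fun t => \sum_(k < r) a k * echar (x k * t)) =
  (complex.Re (\sum_(k < r) \sum_(l < r) a k * conjc (a l) * fourier mu (x k - x l)))%:E.
Proof.
have E t : sqn (\sum_(k < r) a k * echar (x k * t)) =
    \sum_(k < r) \sum_(l < r)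
      complex.Re (a k * conjc (a l) * echar ((x k - x l) * t)).
  have -> : sqn (\sum_(k < r) a k * echar (x k * t)) =
      complex.Re ((sqn (\sum_(k < r) a k * echar (x k * t)))%:C) by [].
  rewrite sqn_sum complex_Re_sum; apply: eq_bigr => k _.
  rewrite complex_Re_sum; apply: eq_bigr => l _.
  by rewrite conjcM mulrACA -echarN -echarD mulrBl.
rewrite /energy; under eq_integral do rewrite E -sumEFin.
rewrite integral_sum//=; last first.
  move=> k; under eq_fun do rewrite -sumEFin; apply: integrable_sum => //= l _.
  exact: (integral_Re_echarM _ _).1.
rewrite complex_Re_sum -sumEFin; apply: eq_bigr => k _; under eq_integral do rewrite -sumEFin.
rewrite integral_sum//=; last by move=> l; exact: (integral_Re_echarM _ _).1.
rewrite complex_Re_sum -sumEFin; apply: eq_bigr => l _.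
rewrite -(integral_Re_echarM _ _).2 /Rintegral fineK//.
apply: integrable_fin_num => //; exact: (integral_Re_echarM _ _).1.
Qed.

(** Pythagoras: the last sum vanishes for the orthogonal projection, where the coefficients
    are the Fourier coefficients. *)
Lemma energy_echar_sub xi (s : seq R) (c : R -> R[i]) : uniq s ->
  {in s &, forall x y, x != y -> fourier mu (x - y) = 0} ->
  energy (fun t => echar (- (xi * t)) - \sum_(x <- s) c x * echar (- (x * t))) =
  (1 - \sum_(x <- s) sqn (fourier mu (x - xi)) +
   \sum_(x <- s) sqn (c x - fourier mu (x - xi)))%:E.
Proof.
move=> us os.
pose a k := if k is k'.+1 then - c s`_k' else 1 : R[i].
pose x k := if k is k'.+1 then - s`_k' else - xi : R.
have -> : (fun t => echar (- (xi * t)) - \sum_(x <- s) c x * echar (- (x * t))) =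
    (fun t => \sum_(k < (size s).+1) a k * echar (x k * t)).
  apply/funext => t; rewrite big_ord_recl/= mul1r mulNr; congr (_ + _).
  rewrite (big_nth 0) big_mkord -sumrN; apply: eq_bigr => i _.
  by rewrite add0n !mulNr.
rewrite energy_trig; congr EFin.
rewrite big_ord_recl/= big_ord_recl/= conjc1 subrr fourier0 !mulr1.
have F (i : 'I_(size s)) :
    \sum_(j < (size s).+1) a i.+1 * conjc (a j) * fourier mu (- s`_i - x j) =
   - (c s`_i * conjc (fourier mu (s`_i - xi))) + c s`_i * conjc (c s`_i).
  rewrite big_ord_recl/= conjc1 mulr1 opprK addrC mulNr -fourierN opprB addrC.
  rewrite [X in _ + X = _](_ : _ = c s`_i * conjc (c s`_i)); last first.
    rewrite (bigD1 i)//= rmorphN/= mulrNN subrr fourier0 mulr1 big1 ?addr0//.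
    move=> j ji; rewrite (_ : - s`_i + - - s`_j = s`_j - s`_i); last by ring.
    by rewrite os ?mulr0// ?mem_nth// nth_uniq.
  by congr (- (_ * fourier mu _) + _); ring.
rewrite (eq_bigr _ (fun i _ => F i)).
have -> : \sum_(i < size s) 1 * conjc (- c s`_i) * fourier mu (- xi - - s`_i) =
   \sum_(i < size s) - (conjc (c s`_i) * fourier mu (s`_i - xi)).
  apply: eq_bigr => i _; rewrite rmorphN/= mul1r mulNr.
  by congr (- (_ * fourier mu _)); ring.
rewrite -addrA -big_split/= complex_ReD complex_Re_sum -addrA; congr (_ + _).
rewrite !(big_nth (0 : R)) !big_mkord -sumrN -big_split/=; apply: eq_bigr => i _.
case: (c s`_i) => p q; case: (fourier mu (s`_i - xi)) => u v.
by rewrite /conjc /sqn /=; ring.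
Qed.

Lemma expi_echar x t : expi (- (2 * pi * x * t)) = echar (- (x * t)) :> R[i].
Proof. by rewrite /echar mulrN !mulrA. Qed.

Lemma dotL2_echar x y :
  dotL2 mu (fun t : borelR => expi (- (2 * pi * x * t)))
           (fun t : borelR => expi (- (2 * pi * y * t))) = fourier mu (y - x).
Proof.
have E t : expi (- (2 * pi * x * t)) * (expi (- (2 * pi * y * t)))^* =
    echar ((y - x) * t) :> R[i].
  rewrite !expi_echar (_ : _^* = conjc (echar (- (y * t)))) // -echarN -echarD opprK.
  by congr echar; ring.
by rewrite /dotL2 /fourier; congr (_ +i* _); apply: eq_Rintegral => t _; rewrite E.
Qed.

Lemma inL2_echar x : inL2 mu (fun t : borelR => expi (- (2 * pi * x * t))).
Proof.
have E : (fun t : borelR => expi (- (2 * pi * x * t))) =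
    (fun t => echar (- x * t)) :> (_ -> R[i]).
  by apply/funext => t; rewrite expi_echar mulNr.
rewrite E; split; [exact: measurable_Re_echar|exact: measurable_Im_echar|].
rewrite normL2_lty /energy; under eq_integral do rewrite sqn_echar.
by rewrite integral_cst// mul1e ltey_eq fin_num_measure.
Qed.

End energy.

(** * L^2 closures *)

Section closure.
Context {R : realType}.
Local Notation borelR := (measurableTypeR R).
Variable mu : probability borelR R.
Implicit Types (f g h : borelR -> R[i]) (x y t xi : R).

Definition cmeasurable f : Prop :=
  measurable_fun setT (fun x => complex.Re (f x)) /\
  measurable_fun setT (fun x => complex.Im (f x)).

Lemma cmeasurableD f g : cmeasurable f -> cmeasurable g ->
  cmeasurable (fun x => f x + g x).
Proof.
move=> [fR fI] [gR gI]; split.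
  by under eq_fun do rewrite complex_ReD; exact: measurable_funD.
by under eq_fun do rewrite complex_ImD; exact: measurable_funD.
Qed.

Lemma cmeasurableM f g : cmeasurable f -> cmeasurable g ->
  cmeasurable (fun x => f x * g x).
Proof.
move=> [fR fI] [gR gI]; split.
  by under eq_fun do rewrite complex_ReM; apply: measurable_funB; exact: measurable_funM.
by under eq_fun do rewrite complex_ImM; apply: measurable_funD; exact: measurable_funM.
Qed.

Lemma cmeasurable_cst (z : R[i]) : cmeasurable (fun=> z).
Proof. by split; exact: measurable_cst. Qed.

Lemma cmeasurable_real (f : borelR -> R) : measurable_fun setT f ->
  cmeasurable (fun x => (f x)%:C).
Proof. by move=> mf; split => //; exact: measurable_cst. Qed.

Lemma cmeasurable_echar xi : cmeasurable (fun x => echar (xi * x)).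
Proof. by split; [exact: measurable_Re_echar|exact: measurable_Im_echar]. Qed.

Lemma cmeasurableB f g : cmeasurable f -> cmeasurable g ->
  cmeasurable (fun x => f x - g x).
Proof.
move=> mf mg.
have := cmeasurableD mf (cmeasurableM (cmeasurable_cst (-1)) mg).
by congr cmeasurable; apply/funext => x; rewrite mulN1r.
Qed.

Lemma measurable_sqn f : cmeasurable f -> measurable_fun setT (fun x => (sqn (f x))%:E).
Proof.
move=> [fR fI]; apply/measurable_EFinP.
by apply: measurable_funD; exact: measurable_funX.
Qed.

Lemma sqnD_le (z u : R[i]) : sqn (z + u) <= 2 * (sqn z + sqn u).
Proof.
case: z => a b; case: u => c d; rewrite -subr_ge0 /sqn /=.
rewrite (_ : _ - _ = (a - c) ^+ 2 + (b - d) ^+ 2); last by ring.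
by rewrite addr_ge0// sqr_ge0.
Qed.

Lemma energyD_le f g : cmeasurable f -> cmeasurable g ->
  (energy mu (fun x => (f x + g x)%R) <= 2%:E * (energy mu f + energy mu g))%E.
Proof.
move=> mf mg; rewrite /energy -ge0_integralD//; last 4 first.
- by move=> x _; rewrite lee_fin sqn_ge0.
- exact: measurable_sqn.
- by move=> x _; rewrite lee_fin sqn_ge0.
- exact: measurable_sqn.
rewrite -ge0_integralZl//; last 2 first.
- by apply: emeasurable_funD; exact: measurable_sqn.
- by move=> x _; rewrite adde_ge0// lee_fin sqn_ge0.
apply: ge0_le_integral => //.
- by move=> x _; rewrite lee_fin sqn_ge0.
- by apply: measurable_sqn; exact: cmeasurableD.
- apply: measurable_funeM; by apply: emeasurable_funD; exact: measurable_sqn.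
- by move=> x _; rewrite -EFinD -EFinM lee_fin sqnD_le.
Qed.

Lemma energyZ (a : R[i]) f : cmeasurable f ->
  energy mu (fun x => a * f x) = ((sqn a)%:E * energy mu f)%E.
Proof.
move=> mf; rewrite /energy; under eq_integral do rewrite sqnM EFinM.
rewrite ge0_integralZl//; first exact: measurable_sqn.
- by move=> x _; rewrite lee_fin sqn_ge0.
- by rewrite lee_fin sqn_ge0.
Qed.

Lemma lt_double_quarter (a b : \bar R) (eps : R) :
  (a < (eps / 4)%:E -> b < (eps / 4)%:E -> 2%:E * (a + b) < eps%:E)%E.
Proof.
move=> ae be; rewrite [in ltRHS](_ : eps = 2 * (eps / 4 + eps / 4)); last by lra.
by rewrite EFinM lte_pmul2l// EFinD lteD.
Qed.

Variable V : set (borelR -> R[i]).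
Hypothesis Vmeas : forall f, V f -> cmeasurable f.
Hypothesis VD : forall f g, V f -> V g -> V (fun x => f x + g x).
Hypothesis VZ : forall a f, V f -> V (fun x => a * f x).

Definition L2_closure f := cmeasurable f /\
  forall eps : R, 0 < eps -> exists2 p, V p & (energy mu (fun x => (f x - p x)%R) < eps%:E)%E.

Lemma L2_closure_closed f : cmeasurable f ->
  (forall eps : R, 0 < eps ->
    exists2 g, L2_closure g & (energy mu (fun x => (f x - g x)%R) < eps%:E)%E) ->
  L2_closure f.
Proof.
move=> mf fg; split => // eps e0; have e4 : 0 < eps / 4 by lra.
have [g [mg gp] fge] := fg _ e4; have [p Vp gpe] := gp _ e4.
exists p => //; have mp := Vmeas Vp.
rewrite (_ : (fun x => f x - p x) = (fun x => (f x - g x) + (g x - p x))); last first.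
  by apply/funext => x; rewrite addrA subrK.
apply: (le_lt_trans (energyD_le (cmeasurableB mf mg) (cmeasurableB mg mp))).
exact: lt_double_quarter.
Qed.

Lemma L2_closureD f g : L2_closure f -> L2_closure g -> L2_closure (fun x => f x + g x).
Proof.
move=> [mf fp] [mg gp]; split; first exact: cmeasurableD.
move=> eps e0; have e4 : 0 < eps / 4 by lra.
have [p Vp fpe] := fp _ e4; have [r Vr gre] := gp _ e4.
exists (fun x => p x + r x); first exact: VD.
have mp := Vmeas Vp; have mr := Vmeas Vr.
rewrite (_ : (fun x => _) = (fun x => (f x - p x) + (g x - r x))); last first.
  by apply/funext => x; rewrite opprD addrACA.
apply: (le_lt_trans (energyD_le (cmeasurableB mf mp) (cmeasurableB mg mr))).
exact: lt_double_quarter.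
Qed.

Lemma L2_closureZ a f : L2_closure f -> L2_closure (fun x => a * f x).
Proof.
move=> [mf fp]; split; first exact: cmeasurableM (cmeasurable_cst a) mf.
move=> eps e0; have s0 : 0 < sqn a + 1 by rewrite ltr_wpDl// sqn_ge0.
have [p Vp fpe] := fp (eps / (sqn a + 1)) (divr_gt0 e0 s0).
exists (fun x => a * p x); first exact: VZ.
rewrite (_ : (fun x => _) = (fun x => a * (f x - p x))); last first.
  by apply/funext => x; rewrite mulrBr.
rewrite energyZ; last exact: cmeasurableB mf (Vmeas Vp).
apply: (@le_lt_trans _ _ ((sqn a + 1)%:E * energy mu (fun x => (f x - p x)%R)))%E.
  rewrite lee_wpmul2r//; last by rewrite lee_fin lerDl.
  by apply: integral_ge0 => x _; rewrite lee_fin sqn_ge0.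
rewrite (_ : eps = (sqn a + 1) * (eps / (sqn a + 1))); last by rewrite mulrC divfK// gt_eqF.
by rewrite EFinM lte_pmul2l.
Qed.

Lemma L2_closureB f g : L2_closure f -> L2_closure g -> L2_closure (fun x => f x - g x).
Proof.
move=> cf cg; have := L2_closureD cf (L2_closureZ (-1) cg).
by congr L2_closure; apply/funext => x; rewrite mulN1r.
Qed.

Lemma energy0 : energy mu (fun=> 0) = 0%E.
Proof. by rewrite /energy integral0_eq// => x _; rewrite /sqn /= expr0n addr0. Qed.

Lemma L2_closure_sub f : V f -> L2_closure f.
Proof.
move=> Vf; split; first exact: Vmeas.
move=> eps e0; exists f => //; under eq_fun do rewrite subrr.
by rewrite energy0 lte_fin.
Qed.

Definition real_closure (f : borelR -> R) := L2_closure (fun x => (f x)%:C).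

(** Dominated convergence; all the approximations in the density theorem below go through it. *)
Lemma real_closure_cvg (fs : nat -> borelR -> R) (f g : borelR -> R) :
  measurable_fun setT f -> measurable_fun setT g ->
  mu.-integrable setT (EFin \o (fun x => g x ^+ 2)) ->
  (forall n, real_closure (fs n)) -> (forall n x, `|fs n x| <= g x) ->
  (forall x, fs n x @[n --> \oo] --> f x) -> real_closure f.
Proof.
move=> mf mg ig cfs fsg fsf.
have mfs n : measurable_fun setT (fs n) by have [[]] := cfs n.
apply: L2_closure_closed; first exact: cmeasurable_real.
move=> eps e0.
have fg x : `|f x| <= g x.
  have : `|fs n x| @[n --> \oo] --> `|f x| by apply: cvg_norm; exact: fsf.
  by move=> h; apply: (cvgr_to_le h); apply: nearW => n; exact: fsg.
have sE n x : sqn ((f x)%:C - (fs n x)%:C) = (f x - fs n x) ^+ 2.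
  by rewrite -rmorphB sqn_real.
have : (\int[mu]_x (sqn ((f x)%:C - (fs n x)%:C)%R)%:E)%E @[n --> \oo] -->
       (\int[mu]_x (cst 0%E x : \bar R))%E.
  apply: (@dominated_cvg _ _ _ mu setT measurableT _ _ (fun x => 4%:E * (g x ^+ 2)%:E)%E).
  - move=> n; apply: measurable_sqn; apply: cmeasurableB; exact: cmeasurable_real.
  - move=> x _; apply: cvg_EFin; first by apply: nearW.
    rewrite /comp/=; under eq_fun do rewrite sE.
    have h : f x - fs n x @[n --> \oo] --> (0 : R).
      by rewrite -(subrr (f x)); apply: cvgB; [exact: cvg_cst|exact: fsf].
    by have := cvgM h h; rewrite mulr0; exact.
  - by [].
  - exact: integrableZl.
  - move=> n x _; rewrite gee0_abs ?lee_fin ?sqn_ge0// sE.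
    have := fg x; have := fsg n x; rewrite !ler_norml => /andP[? ?] /andP[? ?].
    nra.
rewrite integral0 => cv.
have /cv[n _ /(_ n (leqnn n)) lt_n] : nbhs (0%E : \bar R) [set y | (y < eps%:E)%E].
  by apply: open_nbhs_nbhs; split; [exact: open_ereal_lt_ereal|rewrite /= lte_fin].
by exists (fun x => (fs n x)%:C); [exact: cfs|exact: lt_n].
Qed.

End closure.

(** * Polynomials approximating a step *)

Section step_polynomials.
Context {R : realType}.
Implicit Types (x t r : R).

Lemma bernoulli_le x n : 0 <= x <= 1 -> 1 - n%:R * x <= (1 - x) ^+ n.
Proof.
move=> /andP[x0 x1]; elim: n => [|n IH]; first by rewrite mul0r subr0 expr0.
rewrite exprSr (le_trans _ (ler_wpM2r _ IH)) ?subr_ge0//.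
by rewrite -natr1; have : 0 <= n%:R * x * x; [rewrite !mulr_ge0|lra].
Qed.

Lemma bernoulli_ge x n : 0 <= x -> 1 + n%:R * x <= (1 + x) ^+ n.
Proof.
move=> x0; elim: n => [|n IH]; first by rewrite mul0r addr0 expr0.
rewrite exprSr (le_trans _ (ler_wpM2r _ IH)) ?addr_ge0//.
by rewrite -natr1; have : 0 <= n%:R * x * x; [rewrite !mulr_ge0|lra].
Qed.

(** Compare [r] with the square of [s = (1 + r) / 2], which is still less than 1: one factor
    [s ^ n] absorbs [n] by Bernoulli's inequality, the other one tends to 0. *)
Lemma cvg_natmul_expr r : 0 <= r < 1 -> n%:R * r ^+ n @[n --> \oo] --> (0 : R).
Proof.
move=> /andP[r0 r1]; pose s := (1 + r) / 2.
have s0 : 0 < s by rewrite /s; lra.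
have s1 : s < 1 by rewrite /s; lra.
have rs : r <= s ^+ 2 by have := sqr_ge0 (1 - r); rewrite /s; lra.
pose d := s^-1 - 1; have d0 : 0 < d by rewrite subr_gt0 invf_gt1.
have ns n : n%:R * s ^+ n <= d^-1.
  have := bernoulli_ge n (ltW d0); have -> : 1 + d = s^-1 by rewrite /d addrC subrK.
  rewrite exprVn => h.
  rewrite -[leRHS]mul1r ler_pdivlMr// mulrAC -ler_pdivlMr ?exprn_gt0// mul1r.
  by apply: le_trans h; rewrite addrC lerDl.
have cs : d^-1 * s ^+ n @[n --> \oo] --> (0 : R).
  rewrite -[X in _ --> X](mulr0 d^-1); apply: cvgMr; apply: cvg_expr.
  by rewrite ger0_norm// ltW.
apply: (squeeze_cvgr _ (cvg_cst 0) cs); apply: nearW => n.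
rewrite mulr_ge0 ?exprn_ge0//=.
apply: (@le_trans _ _ (n%:R * (s ^+ 2) ^+ n)).
  by rewrite ler_wpM2l// lerXn2r ?nnegrE ?exprn_ge0// ltW.
rewrite -exprM mulnC exprM expr2 mulrA ler_wpM2r//.
  by rewrite exprn_ge0// ltW.
Qed.

(** Both bounds come from Bernoulli's inequality.  The extra factor [n] in the exponent makes the
    limit 0 at the threshold [t = 1 / 2] itself, so that the limit is an indicator everywhere. *)
Lemma cvg_step t : 0 <= t <= 1 ->
  ((1 - t ^+ n) ^+ (n * 2 ^ n) : R) @[n --> \oo] --> ((t < 1 / 2)%R%:R : R).
Proof.
move=> /andP[t0 t1]; have [t2|t2] := ltP t (1 / 2).
  have c : 1 - n%:R * (2 * t) ^+ n @[n --> \oo] --> (1 : R).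
    rewrite -[X in _ --> X]subr0; apply: cvgB; first exact: cvg_cst.
    by apply: cvg_natmul_expr; apply/andP; split; lra.
  suff h : \forall n \near \oo,
      1 - n%:R * (2 * t) ^+ n <= (1 - t ^+ n) ^+ (n * 2 ^ n) <= (1 : R).
    have c1 : (fun=> 1 : R) @ \oo --> (1 : R) by exact: cvg_cst.
    have h1 := squeeze_cvgr h c c1; exact: h1.
  apply: nearW => n.
  have tn : 0 <= t ^+ n <= 1 by rewrite exprn_ge0//= exprn_ile1.
  apply/andP; split; last by rewrite exprn_ile1//; move: tn => /andP[? ?]; lra.
  apply: le_trans (bernoulli_le _ tn); rewrite exprMn natrM natrX.
  by rewrite -mulrA.
have c : (n.+1%:R : R)^-1 @[n --> \oo] --> (0 : R) by exact: cvg_harmonic.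
suff h : \forall n \near \oo, 0 <= (1 - t ^+ n) ^+ (n * 2 ^ n) <= (n.+1%:R : R)^-1.
  have c0 : (fun=> 0 : R) @ \oo --> (0 : R) by exact: cvg_cst.
  have h0 := squeeze_cvgr h c0 c; exact: h0.
apply: nearW => n.
have tn0 : 0 <= t ^+ n by rewrite exprn_ge0.
have tn1 : t ^+ n <= 1 by rewrite exprn_ile1.
set k := (n * 2 ^ n)%N; have h0 : 0 <= (1 - t ^+ n) ^+ k by rewrite exprn_ge0// subr_ge0.
rewrite h0/= -[leRHS]mul1r ler_pdivlMr//.
apply: (@le_trans _ _ ((1 - t ^+ n) ^+ k * (1 + t ^+ n) ^+ k)).
  rewrite ler_wpM2l// (le_trans _ (bernoulli_ge _ tn0))// /k natrM natrX -natr1 addrC.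
  rewrite lerD2l -mulrA -exprMn ler_peMr// exprn_ege1//; lra.
rewrite -exprMn -subr_sqr expr1n exprn_ile1 ?gerBl ?sqr_ge0//.
by rewrite subr_ge0 exprn_ile1.
Qed.

End step_polynomials.

(** * Density of trigonometric polynomials *)

Section trigonometric_polynomials.
Context {R : realType}.
Local Notation borelR := (measurableTypeR R).
Implicit Types (Lam : set R) (f g : borelR -> R[i]) (x t : R).

Definition trig_sum (l : seq (R[i] * R)) (t : borelR) : R[i] :=
  \sum_(p <- l) p.1 * echar (- (p.2 * t)).

Definition trig_poly Lam f :=
  exists2 l, forall p, p \in l -> Lam p.2 & f = trig_sum l.

Lemma trig_poly_measurable Lam f : trig_poly Lam f -> cmeasurable f.
Proof.
move=> [l _ ->]; rewrite /trig_sum; elim: l => [|p l IH].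
  by under eq_fun do rewrite big_nil; exact: cmeasurable_cst.
under eq_fun do rewrite big_cons; apply: cmeasurableD => //.
apply: cmeasurableM; first exact: cmeasurable_cst.
by under eq_fun do rewrite -mulNr; exact: cmeasurable_echar.
Qed.

Lemma trig_polyD Lam f g : trig_poly Lam f -> trig_poly Lam g ->
  trig_poly Lam (fun t => f t + g t).
Proof.
move=> [l lL ->] [l' lL' ->]; exists (l ++ l').
  by move=> p; rewrite mem_cat => /orP[/lL|/lL'].
by apply/funext => t; rewrite /trig_sum big_cat.
Qed.

Lemma trig_polyZ Lam a f : trig_poly Lam f -> trig_poly Lam (fun t => a * f t).
Proof.
move=> [l lL ->]; exists [seq (a * p.1, p.2) | p <- l].
  by move=> _ /mapP[p /lL ? ->].
apply/funext => t; rewrite /trig_sum big_map mulr_sumr.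
by apply: eq_bigr => p _; rewrite mulrA.
Qed.

Lemma trig_poly_echar Lam x : Lam x -> trig_poly Lam (fun t => echar (- (x * t))).
Proof.
move=> Lx; exists [:: (1, x)]; first by move=> p; rewrite inE => /eqP ->.
by apply/funext => t; rewrite /trig_sum big_seq1 mul1r.
Qed.

Lemma trig_polyM f g : trig_poly setT f -> trig_poly setT g ->
  trig_poly setT (fun t => f t * g t).
Proof.
move=> [l _ ->] [l' _ ->].
exists [seq (p.1 * q.1, p.2 + q.2) | p <- l, q <- l'] => //.
apply/funext => t; rewrite /trig_sum big_allpairs_dep/= mulr_suml; apply: eq_bigr => p _.
rewrite mulr_sumr; apply: eq_bigr => q _ /=.
by rewrite mulrACA -echarD; congr (_ * echar _); ring.
Qed.

Definition real_trig (f : R -> R) := trig_poly setT (fun t => (f t)%:C).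

Lemma real_trig_cst (a : R) : real_trig (fun=> a).
Proof.
have := trig_polyZ a%:C (trig_poly_echar (I : setT (0 : R))).
by congr trig_poly; apply/funext => t; rewrite mul0r oppr0 echar0 mulr1.
Qed.

Lemma real_trigM (f g : R -> R) : real_trig f -> real_trig g ->
  real_trig (fun t => f t * g t).
Proof.
by move=> hf hg; have := trig_polyM hf hg; congr trig_poly; apply/funext => t; rewrite rmorphM.
Qed.

Lemma real_trigB (f g : R -> R) : real_trig f -> real_trig g ->
  real_trig (fun t => f t - g t).
Proof.
move=> hf hg; have := trig_polyD hf (trig_polyZ (-1) hg).
by congr trig_poly; apply/funext => t; rewrite mulN1r rmorphB.
Qed.

Lemma real_trigX (f : R -> R) n : real_trig f -> real_trig (fun t => f t ^+ n).
Proof.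
move=> hf; elim: n => [|n IH]; first by under eq_fun do rewrite expr0; exact: real_trig_cst.
by under eq_fun do rewrite exprS; exact: real_trigM.
Qed.

Lemma real_trig_sin (w a : R) : real_trig (fun t => sin (2 * pi * (w * (t - a)))).
Proof.
have E y : (sin (2 * pi * y))%:C =
    (0 -i* (1 / 2)) * (echar y + (-1) * echar (- y)) :> R[i].
  rewrite echarN mulN1r /echar /expi /conjc.
  by apply/eqP; rewrite eq_complex /=; apply/andP; split; apply/eqP; field.
have hp := trig_polyZ (echar (- (w * a))) (trig_poly_echar (I : setT (- w))).
have hm := trig_polyZ (echar (w * a)) (trig_poly_echar (I : setT w)).
have := trig_polyZ (0 -i* (1 / 2)) (trig_polyD hp (trig_polyZ (-1) hm)).
congr trig_poly; apply/funext => t; rewrite E -!echarD.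
by congr (_ * (echar _ + _ * echar _)); ring.
Qed.

End trigonometric_polynomials.

Import HBSimple HBNNSimple.

Section density.
Context {R : realType}.
Local Notation borelR := (measurableTypeR R).
Variable mu : probability borelR R.
Variable Lam : set R.
Hypothesis echar_closure : forall xi,
  L2_closure mu (trig_poly Lam) (fun t => echar (- (xi * t))).
Implicit Types (f g : borelR -> R[i]) (x t : R).

Let Vmeas := @trig_poly_measurable R Lam.
Let VD := @trig_polyD R Lam.
Let VZ := @trig_polyZ R Lam.
Local Notation W := (L2_closure mu (trig_poly Lam)).
Local Notation WR := (real_closure mu (trig_poly Lam)).

Lemma trig_poly_closure f : trig_poly setT f -> W f.
Proof.
move=> [l _ ->]; rewrite /trig_sum; elim: l => [|p l IH].
  apply: (L2_closure_sub _ Vmeas); exists [::] => //.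
under eq_fun do rewrite big_cons.
exact: (L2_closureD Vmeas VD (L2_closureZ Vmeas VZ _ (echar_closure _)) IH).
Qed.

Lemma integrable_sqr_bounded (c : R) :
  mu.-integrable setT (EFin \o (fun _ : borelR => c ^+ 2)).
Proof. exact: finite_measure_integrable_cst. Qed.

Lemma real_trig_closure (f : R -> R) : real_trig f -> WR f.
Proof. exact: trig_poly_closure. Qed.

(** The step polynomials composed with [(1 - sin) / 2], which is less than [1 / 2] exactly where
    the sine is positive. *)
Lemma half_circle_closure (w a : R) :
  WR (fun t => (0 < sin (2 * pi * (w * (t - a))))%R%:R).
Proof.
pose u t := 1 / 2 * (1 - sin (2 * pi * (w * (t - a)))) : R.
have u01 t : 0 <= u t <= 1.
  by rewrite /u; have := sin_le1 (2 * pi * (w * (t - a)));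
     have := sin_geN1 (2 * pi * (w * (t - a))); move=> ? ?; apply/andP; split; lra.
have Tu : real_trig u.
  apply: real_trigM; first exact: real_trig_cst.
  by apply: real_trigB; [exact: real_trig_cst|exact: real_trig_sin].
pose fs (n : nat) t := (1 - u t ^+ n) ^+ (n * 2 ^ n).
have Tfs n : WR (fs n).
  apply: real_trig_closure; apply: real_trigX; apply: real_trigB; first exact: real_trig_cst.
  exact: real_trigX.
have cfs t : fs n t @[n --> \oo] --> ((0 < sin (2 * pi * (w * (t - a))))%R%:R : R).
  rewrite (_ : (0 < _) = (u t < 1 / 2)); first exact: cvg_step.
  by rewrite /u; apply/idP/idP => ?; lra.
have mfs n : measurable_fun setT (fs n) by have [[]] := Tfs n.
apply: (real_closure_cvg Vmeas (fs := fs) (g := fun=> 1)) => //.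
- apply: (@measurable_fun_cvg _ _ _ _ fs) => // t _; exact: cfs.
- exact: integrable_sqr_bounded.
- move=> n t; have /andP[u0 u1] := u01 t.
  have h : 0 <= 1 - u t ^+ n <= 1.
    by rewrite subr_ge0 exprn_ile1//= gerBl exprn_ge0.
  by move/andP: h => [h0 h1]; rewrite ger0_norm ?exprn_ge0// exprn_ile1.
Qed.

(** As the period grows, the positive half-period starting at [a] fills the ray. *)
Lemma ray_closure (a : R) : WR (\1_(`]a, +oo[%classic : set R)).
Proof.
pose fs (n : nat) (t : borelR) := (0 < sin (2 * pi * ((n.+1%:R)^-1 * (t - a))))%R%:R : R.
have cfs t : fs n t @[n --> \oo] --> (\1_(`]a, +oo[%classic : set R) t : R).
  apply: cvg_near_cst.
  have p0 := pi_gt0 R.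
  near=> n.
  have nt : 2 * `|t - a| < n.+1%:R.
    rewrite (lt_trans (truncnS_gt _))// ltr_nat ltnS; near: n; exact: nbhs_infty_gt.
  have n0 : (0 : R) < n.+1%:R by rewrite ltr0n.
  rewrite /fs indicE mem_setE in_itv/= andbT; congr (_%:R); congr nat_of_bool.
  set v := n.+1%:R^-1 * (t - a).
  have vt : t - a = n.+1%:R * v by rewrite /v mulVKf// gt_eqF.
  have v1 : `|v| < 1 / 2.
    rewrite /v normrM gtr0_norm ?invr_gt0// mulrC ltr_pdivrMr//; lra.
  move: v1; rewrite ltr_norml => /andP[v1 v2].
  have -> : (a < t) = (0 < v) by rewrite -subr_gt0 vt pmulr_rgt0.
  have [v0|v0] := ltP 0 v.
    by apply: sin_gt0_pi; apply/andP; split; nra.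
  apply/negbTE; rewrite -leNgt -oppr_ge0 -sinN.
  by apply: sin_ge0_pi; apply/andP; split; nra.
apply: (real_closure_cvg Vmeas (fs := fs) (g := fun=> 1)) => //.
- exact: integrable_sqr_bounded.
- by move=> n; exact: half_circle_closure.
- by move=> n t; rewrite /fs; case: (0 < _)%R; rewrite ?normr1 ?normr0.
Unshelve. all: by end_near. Qed.

(** The sets whose indicators are approximable form a lambda-system, which contains the rays. *)
Lemma indic_closure (E : set borelR) : measurable E -> WR (\1_E : borelR -> R).
Proof.
pose H := [set E : set borelR | measurable E /\ WR (\1_E : borelR -> R)].
suff : <<s RGenOInfty.G (R := R) >> `<=` H.
  move=> GH mE; apply: (GH E _).2.
  by move: mE; rewrite RGenOInfty.measurableE.
apply: lambda_system_subset => //.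
- move=> _ _ [x ->] [y ->]; exists (Num.max x y).
  apply/seteqP; split => z /=; rewrite !in_itv/= !andbT gt_max.
    by move=> [-> ->].
  by move=> /andP.
- split => //.
  + split => //; rewrite indicT; exact: real_trig_closure (real_trig_cst 1).
  + move=> A B BA [mA cA] [mB cB]; split; first exact: measurableD.
    have := L2_closureB Vmeas VD VZ cA cB; congr L2_closure; apply/funext => t.
    rewrite -rmorphB/= !indicE in_setD; congr (_%:C).
    case: (boolP (t \in B)) => tB; last by rewrite subr0 andbT.
    by rewrite (_ : t \in A) ?subrr//; move: tB; rewrite !inE; exact: BA.
  + move=> F ndF FH; have mF i : measurable (F i) by have [] := FH i.
    have mU : measurable (\bigcup_i F i) by apply: bigcup_measurable => i _; exact: mF.
    split; first exact: mU.
    apply: (real_closure_cvg Vmeas (fs := fun n => \1_(F n)) (g := fun=> 1)) => //.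
    * exact: integrable_sqr_bounded.
    * by move=> n; have [] := FH n.
    * by move=> n t; rewrite indicE; case: (_ \in _); rewrite ?normr1 ?normr0.
    * move=> t; apply: cvg_near_cst.
      have [[i _ Fit]|nF] := pselect ((\bigcup_i F i) t); last first.
        apply: nearW => n; rewrite !indicE !memNset//.
        by move=> Fnt; apply: nF; exists n.
      exists i => // n /= iN; rewrite !indicE !mem_set//; first by exists i.
      by have /subsetPset := ndF _ _ iN; exact.
- move=> _ [x ->]; split; last exact: ray_closure.
  exact: measurable_itv.
Qed.

(** Nonnegative functions are increasing limits of simple functions, dominated by the function
    itself. *)
Lemma sqr_integrable_closure (f : borelR -> R) : measurable_fun setT f ->
  (forall x, 0 <= f x) -> mu.-integrable setT (EFin \o (fun x => f x ^+ 2)) -> WR f.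
Proof.
move=> mf f0 if2.
have mfE : measurable_fun setT (EFin \o f) by exact/measurable_EFinP.
pose fs n (x : borelR) : R := nnsfun_approx measurableT mfE n x.
have cfs x : fs n x @[n --> \oo] --> f x.
  have fE0 (y : borelR) : setT y -> (0 <= (EFin \o f) y)%E by rewrite /= lee_fin.
  exact: (fine_cvg (cvg_nnsfun_approx measurableT mfE fE0 (I : setT x))).
have fsf n x : fs n x <= f x.
  rewrite -(cvg_lim _ (cfs x))//; apply: nondecreasing_cvgn_le.
    by move=> i j ij; have /lefP := nd_nnsfun_approx measurableT mfE ij; exact.
  by apply/cvg_ex; exists (f x); exact: cfs.
have fs0 n x : 0 <= fs n x by exact: fun_ge0.
apply: (real_closure_cvg Vmeas (fs := fs) (g := f)) => //; last first.
  by move=> n x; rewrite ger0_norm.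
move=> n; rewrite /real_closure /fs; set h := nnsfun_approx _ _ _.
rewrite (_ : (fun x => _) = (fun t => \sum_(y <- fset_set (range h))
    y%:C * (\1_(h @^-1` [set y]) t)%:C)); last first.
  apply/funext => t; rewrite fimfunE fsbig_finite//= rmorph_sum; apply: eq_bigr => y _.
  by rewrite rmorphM.
suff S (s : seq R) : W (fun t => \sum_(y <- s) y%:C * (\1_(h @^-1` [set y]) t)%:C).
  exact: S.
elim: s => [|y s IH].
  apply: (L2_closure_sub _ Vmeas); exists [::] => //.
  by apply/funext => t; rewrite /trig_sum !big_nil.
under eq_fun do rewrite big_cons.
apply: (L2_closureD Vmeas VD) => //; apply: (L2_closureZ Vmeas VZ).
by apply: indic_closure; exact: measurable_sfunP.
Qed.

Lemma integrable_sqr_le (f g : borelR -> R) : measurable_fun setT g ->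
  (forall x, `|g x| <= `|f x|) -> mu.-integrable setT (EFin \o (fun x => f x ^+ 2)) ->
  mu.-integrable setT (EFin \o (fun x => g x ^+ 2)).
Proof.
move=> mg gf; apply: le_integrable => //.
  by apply/measurable_EFinP; exact: measurable_funX.
move=> x _ /=; rewrite lee_fin !normrX lerXn2r ?nnegrE//.
Qed.

Lemma real_L2_closure (f : borelR -> R) : measurable_fun setT f ->
  mu.-integrable setT (EFin \o (fun x => f x ^+ 2)) -> WR f.
Proof.
move=> mf if2.
have mp : measurable_fun setT (fun x => Num.max (f x) 0) by exact: measurable_maxr.
have mn : measurable_fun setT (fun x => Num.max (- f x) 0).
  by apply: measurable_maxr => //; exact: measurableT_comp.
have cp : WR (fun x => Num.max (f x) 0).
  apply: sqr_integrable_closure => //; first by move=> x; rewrite le_max lexx orbT.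
  apply: integrable_sqr_le if2 => // x.
  by case: (leP (f x) 0) => h; rewrite ?normr0.
have cn : WR (fun x => Num.max (- f x) 0).
  apply: sqr_integrable_closure => //; first by move=> x; rewrite le_max lexx orbT.
  apply: integrable_sqr_le if2 => // x.
  by case: (leP (- f x) 0) => h; rewrite ?normr0 ?normrN.
have := L2_closureB Vmeas VD VZ cp cn; congr L2_closure; apply/funext => x.
rewrite -rmorphB; congr (_%:C).
by case: (ltrgt0P (f x)) => h; case: (ltrgt0P (- f x)) => h'; lra.
Qed.

(** The hypothesis only concerns characters; the bridge to all of L^2 is made of indicators of
    rays. *)
Theorem L2_dense f : inL2 mu f -> W f.
Proof.
move=> [mR mI]; rewrite normL2_lty => fin.
have msq : measurable_fun setT (fun x => (sqn (f x))%:E) by exact: measurable_sqn.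
have isq : mu.-integrable setT (fun x => (sqn (f x))%:E).
  apply/integrableP; split => //; apply: le_lt_trans fin.
  by rewrite le_eqVlt; apply/orP; left; apply/eqP; apply: eq_integral => x _;
     rewrite gee0_abs// lee_fin sqn_ge0.
have iR : WR (fun x => complex.Re (f x)).
  apply: real_L2_closure => //; apply: le_integrable isq => //.
    by apply/measurable_EFinP; exact: measurable_funX.
  by move=> x _ /=; rewrite lee_fin !ger0_norm ?sqr_ge0 ?sqn_ge0// lerDl sqr_ge0.
have iI : WR (fun x => complex.Im (f x)).
  apply: real_L2_closure => //; apply: le_integrable isq => //.
    by apply/measurable_EFinP; exact: measurable_funX.
  by move=> x _ /=; rewrite lee_fin !ger0_norm ?sqr_ge0 ?sqn_ge0// lerDr sqr_ge0.
have := L2_closureD Vmeas VD iR (L2_closureZ Vmeas VZ 'i%C iI).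
by congr L2_closure; apply/funext => x; rewrite -complexE.
Qed.

End density.

(** * Divisibility implies spectrality *)

Section sufficiency.
Context {R : realType}.
Local Notation borelR := (measurableTypeR R).
Variables (N M : nat -> nat).
Hypothesis hNM : forall k, (1 <= k)%N -> (2 <= M k)%N /\ (M k <= N k)%N.
Hypothesis hdvd : forall k, (2 <= k)%N -> (M k %| N k)%N.
Implicit Types (x y xi l P : R).

(** The representative of [x] modulo [P] in the centered interval; the choice of the ceiling puts
    the right end [P / 2] in the interval and the left end outside. *)
Definition reduce P x : R := x - P * (Num.ceil (x / P - 1 / 2))%:~R.

Definition centered P x := - (P / 2) < x <= P / 2.

Lemma reduce_centered P x : 0 < P -> centered P (reduce P x).
Proof.
move=> P0; rewrite /centered /reduce.
set y := x / P - 1 / 2; have xE : x = P * (y + 1 / 2).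
  by rewrite /y subrK mulrC divfK// gt_eqF.
have c1 : y <= (Num.ceil y)%:~R by exact: ceil_ge.
have c2 : (Num.ceil y)%:~R < y + 1 by have := ceilB1_lt y; rewrite intrB ltrBlDr.
by rewrite xE; apply/andP; split; nra.
Qed.

Lemma reduce_id P x : 0 < P -> centered P x -> reduce P x = x.
Proof.
move=> P0 /andP[x1 x2]; rewrite /reduce.
have -> : Num.ceil (x / P - 1 / 2) = 0.
  apply: ceil_def; rewrite sub0r ltrBrDr lerBlDr ltr_pdivlMr// ler_pdivrMr//.
  by apply/andP; split; lra.
by rewrite mulr0 subr0.
Qed.

(** The digit [d = 0] reproduces the points of the previous stage, which are already reduced, so
    that the stages increase. *)
Fixpoint spectrum_stage n : seq R :=
  if n is n'.+1 then
    [seq reduce (scale N n)%:R (l + (scale N n)%:R / (M n)%:R * d%:R)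
      | l <- spectrum_stage n', d <- iota 0 (M n)]
  else [:: 0].

Lemma spectrum_stage_centered n l : l \in spectrum_stage n ->
  centered (scale N n)%:R l.
Proof.
case: n => [|n] /=.
  by rewrite inE => /eqP ->; rewrite /centered scale0; apply/andP; split; lra.
by move=> /allpairsP[[? ?] [_ _ ->]]; apply: reduce_centered; exact: (scaleR_gt0 hNM).
Qed.

Lemma spectrum_stage_sub n m : (n <= m)%N ->
  {subset spectrum_stage n <= spectrum_stage m}.
Proof.
move=> nm; rewrite -(subnKC nm); elim: (m - n)%N => [|k IH]; first by rewrite addn0.
move=> l /IH {}IH; rewrite addnS; apply/allpairsP; exists (l, 0%N); split => //=.
  by rewrite mem_iota/= (digits_gt0 hNM).
rewrite mulr0 addr0 reduce_id//; first exact: (scaleR_gt0 hNM).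
have := spectrum_stage_centered IH; rewrite /centered scaleS natrM.
have P0 : 0 < (scale N (n + k))%:R :> R by exact: (scaleR_gt0 hNM).
have N2 : 2 <= (N (n + k).+1)%:R :> R.
  by rewrite ler_nat; have [h h'] := @hNM (n + k).+1 isT; exact: leq_trans h'.
by move=> /andP[l1 l2]; apply/andP; split; nra.
Qed.

Lemma partial_weight_periodic n x (z : int) :
  partial_weight N M 0 n (x + (scale N n)%:R * z%:~R) = partial_weight N M 0 n x.
Proof.
rewrite /partial_weight; apply: eq_big_nat => j /andP[j1 jn].
have /dvdnP[r rE] : (scale N j %| scale N n)%N.
  move: jn; rewrite ltnS => jn; rewrite -(subnKC jn); elim: (n - j)%N => [|k IH].
    by rewrite addn0.
  by rewrite addnS scaleS dvdn_mulr.
rewrite rE natrM mulrDl (_ : r%:R * _ * _ / _ = (r%:Z * z)%:~R); first exact: weightDint.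
by rewrite intrM /=; field; rewrite lt0r_neq0// (scaleR_gt0 hNM).
Qed.

(** The only use of divisibility: for [n > 0], [P_(n+1) / M_(n+1)] is an integer multiple of
    [P_n].  For [n = 0] the product is empty, which is why the first digit set is arbitrary. *)
Lemma partial_weight_shift n x (d : nat) (z : int) :
  partial_weight N M 0 n (x + (scale N n.+1)%:R / (M n.+1)%:R * d%:R
                     - (scale N n.+1)%:R * z%:~R) = partial_weight N M 0 n x.
Proof.
case: n => [|n]; first by rewrite !partial_weightnn.
have /dvdnP[r rE] := hdvd (isT : 1 < n.+2)%N.
have m0 : (M n.+2)%:R != 0 :> R by rewrite pnatr_eq0 -lt0n (digits_gt0 hNM).
rewrite -[RHS](partial_weight_periodic n.+1 x (r%:Z * d%:Z - (N n.+2)%:Z * z)).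
by congr partial_weight; rewrite intrB !intrM [scale N n.+2]scaleS rE !natrM /=; field.
Qed.

(** Grouping the points by their predecessor, the new factor sums to 1 over the digits and the
    others do not see them. *)
Lemma spectrum_parseval n x :
  \sum_(l <- spectrum_stage n) partial_weight N M 0 n (l + x) = 1.
Proof.
elim: n x => [|n IH] x; first by rewrite big_seq1 partial_weightnn.
rewrite /= big_allpairs_dep/=.
transitivity (\sum_(l <- spectrum_stage n) partial_weight N M 0 n (l + x)); last exact: IH.
apply: eq_bigr => l _.
set P : R := (scale N n.+1)%:R; set m := M n.+1.
have P0 : P != 0 by rewrite lt0r_neq0// (scaleR_gt0 hNM).
have m0 : m%:R != 0 :> R by rewrite pnatr_eq0 -lt0n (digits_gt0 hNM).
rewrite -[RHS]mulr1 -[X in _ = _ * X](sum_weight ((l + x) / P) (digits_gt0 hNM n)) mulr_sumr.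
rewrite -[m in iota 0 m]subn0 -/(index_iota 0 m) big_mkord; apply: eq_bigr => d _.
rewrite partial_weightS// -/P -/m /reduce; set z := Num.ceil _; congr (_ * _).
  rewrite -[RHS](partial_weight_shift n (l + x) d z) -/P -/m; congr partial_weight; ring.
rewrite -[RHS](weightDint _ _ (- z)) mulrNz; congr weight; field.
by rewrite P0 m0.
Qed.

(** Parseval's identity at a point of the stage contains the term 1, so all the other terms
    vanish, including those of possible repetitions. *)
Lemma spectrum_stage_orth n l : l \in spectrum_stage n ->
  {in rem l (spectrum_stage n), forall l', partial_weight N M 0 n (l' - l) = 0}.
Proof.
move=> ls; have := spectrum_parseval n (- l).
rewrite (perm_big _ (perm_to_rem ls)) big_cons subrr (partial_weight0 hNM).
rewrite -[RHS]addr0 => /addrI /eqP.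
rewrite psumr_eq0; last by move=> ? _; exact: partial_weight_ge0.
by move=> /allP h l' /h /eqP.
Qed.

Lemma spectrum_stage_uniq n : uniq (spectrum_stage n).
Proof.
apply: count_mem_uniq => l; have [ls|ls] := boolP (l \in spectrum_stage n); last first.
  by apply/count_memPn.
have nr : l \notin rem l (spectrum_stage n).
  apply/negP => /(spectrum_stage_orth ls) /eqP.
  by rewrite subrr (partial_weight0 hNM) oner_eq0.
rewrite (permP (perm_to_rem ls)) /= eqxx.
by move/count_memPn: nr => ->.
Qed.

Definition spectrum : set R := [set l | exists n, l \in spectrum_stage n].

Lemma spectrum_orthogonal l l' : spectrum l -> spectrum l' -> l != l' ->
  tail_weight N M 0 (l - l') = 0.
Proof.
move=> [n ln] [n' ln'] ll'; pose m := maxn n n'.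
have lm : l \in spectrum_stage m by apply: spectrum_stage_sub ln; exact: leq_maxl.
have lm' : l' \in spectrum_stage m by apply: spectrum_stage_sub ln'; exact: leq_maxr.
rewrite (tail_weight_split hNM _ (leq0n m)) (spectrum_stage_orth lm') ?mul0r//.
by rewrite mem_rem_uniq ?spectrum_stage_uniq// inE ll'.
Qed.

Lemma countable_spectrum : countable spectrum.
Proof.
rewrite (_ : spectrum = \bigcup_(n in [set: nat]) [set` spectrum_stage n]).
  by apply: bigcup_countable => // n _; exact/finite_set_countable/finite_seq.
by apply/seteqP; split => l; [move=> [n ln]; exists n|move=> [n _ ln]; exists n].
Qed.

Lemma sum_spectrum_stage_sub (f : R -> R) n m : (n <= m)%N ->
  \sum_(l <- spectrum_stage m) f l = \sum_(l <- spectrum_stage n) f l +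
    \sum_(l <- spectrum_stage m | l \notin spectrum_stage n) f l.
Proof.
move=> nm; rewrite (bigID (mem (spectrum_stage n)))/=; congr (_ + _).
rewrite -big_filter; apply: perm_big; apply: uniq_perm.
- by rewrite filter_uniq// spectrum_stage_uniq.
- exact: spectrum_stage_uniq.
- move=> l; rewrite mem_filter; apply/andP/idP => [[]//|ln]; split => //.
  exact: spectrum_stage_sub nm _ ln.
Qed.

(** The points added after stage [m] carry little of the convergent sum of [tail_weight]; as the
    tails are bounded below there, they also carry little of Parseval's identity at every later
    level [n].  So stage [m] carries almost everything at level [n], hence in the limit. *)
Lemma spectrum_complete xi (eps : R) : 0 < eps ->
  exists m, 1 - eps < \sum_(l <- spectrum_stage m) tail_weight N M 0 (l - xi).
Proof.
move=> e0; pose S m := \sum_(l <- spectrum_stage m) tail_weight N M 0 (l - xi).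
have c0 := @sinc_const_gt0 R; set c := sinc_const in c0.
have ndS : nondecreasing_seq S.
  move=> n m nm; rewrite /S (sum_spectrum_stage_sub _ nm) lerDl.
  by apply: sumr_ge0 => l _; exact: (tail_weight_ge0 hNM).
have S1 m : S m <= 1.
  rewrite /S -(big_map (fun l => l - xi) xpredT (tail_weight N M 0)).
  apply: (bessel_tail_weight hNM).
    by rewrite map_inj_uniq ?spectrum_stage_uniq// => ? ? /addIr.
  move=> _ _ /mapP[l ls ->] /mapP[l' ls' ->] ll'.
  rewrite (_ : _ - _ - _ = l - l'); last by ring.
  by apply: spectrum_orthogonal; [exists m|exists m|apply: contra ll' => /eqP ->].
have cS : cvgn S by apply: nondecreasing_is_cvgn => //; exists 1 => _ [m _ <-].
(* beyond [k], translating by [xi] moves the centered interval of half-width [P / 2] into the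
   interval of half-width [2 P / 3] where the tail is bounded below *)
have [k hk] := scaleR_unbounded hNM (6 * `|xi|).
have ec0 : 0 < eps / 2 * c by rewrite mulr_gt0// divr_gt0.
have [m1 _ hm1] : \forall m \near \oo, limn S - eps / 2 * c < S m.
  by apply: (cvgr_gt _ cS); rewrite gtrBl.
pose m := maxn m1 k; exists m.
have Sm : limn S - eps / 2 * c < S m by apply: hm1; exact: leq_maxl.
have low n : (m <= n)%N ->
    1 - eps / 2 <= \sum_(l <- spectrum_stage m) partial_weight N M 0 n (l - xi).
  move=> mn; have := spectrum_parseval n (- xi).
  rewrite (sum_spectrum_stage_sub (fun l => partial_weight N M 0 n (l - xi)) mn) => pE.
  suff : \sum_(l <- spectrum_stage n | l \notin spectrum_stage m)
           partial_weight N M 0 n (l - xi) <= eps / 2 by move: pE; lra.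
  have Sn : S n <= limn S by exact: nondecreasing_cvgn_le.
  rewrite -(ler_pM2r c0) mulr_suml.
  apply: (@le_trans _ _ (\sum_(l <- spectrum_stage n | l \notin spectrum_stage m)
           tail_weight N M 0 (l - xi))); last first.
    move: Sn; rewrite {1}/S (sum_spectrum_stage_sub _ mn) -/(S m); lra.
  rewrite big_seq_cond [leRHS]big_seq_cond; apply: ler_sum => l /andP[ln _].
  rewrite (tail_weight_split hNM _ (leq0n n)) ler_wpM2l ?partial_weight_ge0//.
  apply: (tail_weight_lower hNM).
  have P0 : 0 < (scale N n)%:R :> R by exact: (scaleR_gt0 hNM).
  have kn : 6 * `|xi| <= (scale N n)%:R by apply: hk; rewrite (leq_trans _ mn)// leq_maxr.
  have /andP[l1 l2] := spectrum_stage_centered ln.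
  rewrite normrM normfV (gtr0_norm P0) ler_pdivrMr//.
  rewrite (le_trans (ler_normB _ _))//.
  have : `|l| <= (scale N n)%:R / 2 by rewrite ler_norml l2 andbT ltW.
  lra.
apply: (@lt_le_trans _ _ (1 - eps / 2)); first by lra.
have cw : \sum_(l <- spectrum_stage m) partial_weight N M 0 n (l - xi) @[n --> \oo] -->
    \sum_(l <- spectrum_stage m) tail_weight N M 0 (l - xi).
  apply: cvg_big => [|l _]; first exact: add_continuous.
  exact: (cvg_partial_weight hNM).
by apply: (cvgr_to_ge cw); exists m => // n /= mn; exact: low.
Qed.

Variables (B : nat -> {fset R}) (mu : probability borelR R).
Hypothesis hB : forall k, (1 <= k)%N -> B k = [fset j%:R | j in iota 0 (M k)]%fset.
Hypothesis hmu : is_infinite_convolution N B mu.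

Lemma fourier_spectrum l l' : spectrum l -> spectrum l' -> l != l' ->
  fourier mu (l - l') = 0.
Proof.
move=> Ll Ll' ll'; apply/eqP; rewrite -sqn_eq0 (sqn_fourier hNM hB hmu).
by apply/eqP; exact: spectrum_orthogonal.
Qed.

(** The distance from a character to its projection on a stage is the defect in
    [spectrum_complete]. *)
Lemma echar_closure_spectrum xi :
  L2_closure mu (trig_poly spectrum) (fun t => echar (- (xi * t))).
Proof.
split.
  by under eq_fun do rewrite -mulNr; exact: cmeasurable_echar.
move=> eps e0; have [m hm] := spectrum_complete xi e0.
pose c l := fourier mu (l - xi).
exists (trig_sum [seq (c l, l) | l <- spectrum_stage m]).
  by exists [seq (c l, l) | l <- spectrum_stage m] => // _ /mapP[l ls ->]; exists m.
rewrite (_ : (fun x => _) = fun t =>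
    echar (- (xi * t)) - \sum_(l <- spectrum_stage m) c l * echar (- (l * t))); last first.
  by apply/funext => t; rewrite /trig_sum big_map.
rewrite energy_echar_sub ?spectrum_stage_uniq//; last first.
  by move=> l l' ls ls' ll'; apply: fourier_spectrum => //; exists m.
rewrite [X in _ + X]big1 ?addr0; last first.
  by move=> l _; rewrite subrr /sqn /= expr0n addr0.
rewrite lte_fin; under eq_bigr do rewrite (sqn_fourier hNM hB hmu); lra.
Qed.

(** Repeated frequencies are merged by adding their coefficients. *)
Lemma trig_sum_fset (L : set R) (p : seq (R[i] * R)) : (forall q, q \in p -> L q.2) ->
  exists (s : {fset R}) (c : R -> R[i]), [set` s] `<=` L /\
    trig_sum p = fun t : borelR => \sum_(x <- s) c x * echar (- (x * t)).
Proof.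
move=> pL; exists [fset q.2 | q in p]%fset, (fun x => \sum_(q <- p | q.2 == x) q.1); split.
  by move=> x /= /imfsetP[q /= qp ->]; exact: pL.
apply/funext => t; rewrite /trig_sum.
under [RHS]eq_bigr do rewrite mulr_suml.
rewrite (exchange_big_dep xpredT)//= [LHS]big_seq [RHS]big_seq; apply: eq_bigr => q qp.
rewrite (big_rem q.2)/=; last by apply/imfsetP; exists q.
rewrite eqxx big1_seq ?addr0// => x /andP[/eqP <-].
by rewrite mem_rem_uniq ?fset_uniq// inE eqxx.
Qed.

Lemma dvd_spectral : spectral_measure mu.
Proof.
exists spectrum; first exact: countable_spectrum.
split.
- by move=> l _; exact: inL2_echar.
- move=> l l' Ll Ll'; rewrite dotL2_echar; have [->|ll'] := eqVneq l l'.
    by rewrite subrr fourier0.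
  by rewrite fourier_spectrum// eq_sym.
- move=> f f2 eps e0.
  have [_ /(_ (eps ^+ 2) (exprn_gt0 2 e0))[_ [p pL ->] fp]] :=
    L2_dense echar_closure_spectrum f2.
  have [s [c [sL E]]] := trig_sum_fset pL.
  exists s, c; split => //; rewrite normL2_lt//; apply: le_lt_trans fp.
  rewrite le_eqVlt; apply/orP; left; apply/eqP; congr energy; apply/funext => t.
  by rewrite E; congr (_ - _); apply: eq_bigr => x _; rewrite expi_echar.
Qed.

End sufficiency.

(** * Sums of nonnegative families *)

Section nonnegative_sums.
Context {R : realType}.

Lemma esum_fibers (T1 T2 : choiceType) (A : set T1) (U : set T2) (f : T1 -> T2)
    (a : T1 -> \bar R) :
  (forall x, A x -> U (f x)) -> (forall x, A x -> (0 <= a x)%E) ->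
  \esum_(x in A) a x = \esum_(u in U) \esum_(x in A `&` f @^-1` [set u]) a x.
Proof.
move=> AU a0; rewrite esum_esum; last by move=> i j _ [/a0].
rewrite (@reindex_esum _ _ _ A _ (fun x => (f x, x)))//.
split.
- by move=> x Ax; split => //=; exact: AU.
- by move=> x y _ _ [].
- by move=> [u x]/= [Uu [Ax <-]]; exists x.
Qed.

Lemma esum_pZl (T : choiceType) (A : set T) (r : R) (a : T -> \bar R) : 0 < r ->
  (forall x, A x -> (0 <= a x)%E) ->
  \esum_(x in A) (r%:E * a x)%E = (r%:E * \esum_(x in A) a x)%E.
Proof.
move=> r0 a0; rewrite /esum -ereal_sup_pZl//; congr ereal_sup.
have E X : finite_set X -> X `<=` A ->
    (\sum_(x \in X) (r%:E * a x) = r%:E * \sum_(x \in X) a x)%E.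
  move=> finX XA; rewrite !fsbig_finite//= big_seq [in RHS]big_seq ge0_sume_distrr//.
  by move=> i; rewrite in_fset_set// inE => /XA/a0.
apply/seteqP; split => x.
  by move=> [X [finX XA] <-]; exists (\sum_(x \in X) a x)%E; [exists X|rewrite E].
by move=> [_ [X [finX XA] <-] <-]; exists X; [|exact: E].
Qed.

Lemma esum_le_seq (T : choiceType) (A : set T) (a : T -> R) (b : R) :
  (forall s : seq T, uniq s -> {in s, forall x, A x} -> \sum_(x <- s) a x <= b) ->
  (\esum_(x in A) (a x)%:E <= b%:E)%E.
Proof.
move=> h; apply: ge_ereal_sup => _ [X [finX XA] <-].
rewrite fsbig_finite//= sumEFin lee_fin h// => x.
by rewrite in_fset_set// inE => /XA.
Qed.

Lemma esum_ge_seq (T : choiceType) (A : set T) (a : T -> R) (s : seq T) :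
  uniq s -> {in s, forall x, A x} -> (forall x, 0 <= a x) ->
  ((\sum_(x <- s) a x)%:E <= \esum_(x in A) (a x)%:E)%E.
Proof.
move=> us sA a0; apply: esum_ge; exists [set` s].
  by split; [exact: finite_seq|move=> x /= /sA].
by rewrite -fsbig_seq// sumEFin.
Qed.

End nonnegative_sums.

(** * Spectra of the tails and selections of residues *)

Section selections.
Context {R : realType}.
Variables (N M : nat -> nat).
Hypothesis hNM : forall k, (1 <= k)%N -> (2 <= M k)%N /\ (M k <= N k)%N.
Local Notation T := (tail_weight (R := R) N M).
Implicit Types (Lam : set R) (x y u : R).

(** The multiples of [P / M] contain the zeros of the corresponding factor and are stable under
    translation by [P / M]: no point congruent to a point of the set modulo [P / M] is a zero. *)
Definition generic_set Lam := forall x (k : nat) (z : int), Lam x ->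
  x <> (scale N k.+1)%:R / (M k.+1)%:R * z%:~R.

(** A spectrum of the tail measure translated to a generic position, tested against the constant
    function 1 only: for a generic position this single Parseval identity is enough. *)
Definition tail_spectrum n Lam :=
  [/\ forall x y, Lam x -> Lam y -> x != y -> T n (x - y) = 0,
      generic_set Lam &
      \esum_(x in Lam) (T n x)%:E = 1%E].

Lemma generic_tail_weight_gt0 Lam n x : generic_set Lam -> Lam x -> 0 < T n x.
Proof.
move=> gL Lx; have [k hk] := scaleR_unbounded hNM (`|x| * (3 / 2)).
pose K := maxn k n; have nK : (n <= K)%N by exact: leq_maxr.
rewrite (tail_weight_split hNM x nK) mulr_gt0//; last first.
  rewrite (lt_le_trans _ (tail_weight_lower hNM _))// ?sinc_const_gt0//.
  have s0 : 0 < (scale N K)%:R :> R by exact: (scaleR_gt0 hNM).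
  rewrite normrM normfV (ger0_norm (ltW s0)) ler_pdivrMr//.
  by have := hk K (leq_maxl _ _); lra.
rewrite lt0r partial_weight_ge0 andbT /partial_weight prodf_seq_neq0; apply/allP => -[|j].
  by rewrite mem_index_iota.
move=> _; apply/negP => /eqP /(weight_eq0 (digits_gt0 hNM j))[z xz _].
apply: (gL x j z) => //; rewrite mulrAC -mulrA -xz mulrC divfK//.
by rewrite lt0r_neq0// (scaleR_gt0 hNM).
Qed.

Variable k : nat.
Let P : R := (scale N k.+1)%:R.
Let m := M k.+1.
Let q : R := P / m%:R.

(** With [q] the spacing of the zeros of the factor [k + 1], every [x] is
    [q * (cell_frac x + cell_res x + M * z)] for an integer [z]: [cell_frac] identifies the coset
    modulo [q], and [cell_res] the residue modulo [P = q * M] inside that coset. *)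
Definition cell_frac x : R := x / q - (Num.floor (x / q))%:~R.

Definition cell_res x : nat := `|(Num.floor (x / q) %% m)%Z|%N.

Let m_gt0 : (0 < m)%N. Proof. exact: (digits_gt0 hNM). Qed.

Let mR_neq0 : m%:R != 0 :> R. Proof. by rewrite pnatr_eq0 -lt0n. Qed.

Let P_neq0 : P != 0. Proof. by rewrite lt0r_neq0// (scaleR_gt0 hNM). Qed.

Let q_neq0 : q != 0. Proof. by rewrite mulf_neq0// invr_neq0. Qed.

Let mZ_neq0 : (m : int) != 0. Proof. by rewrite eqz_nat -lt0n. Qed.

Lemma cell_res_lt x : (cell_res x < m)%N.
Proof.
rewrite -ltz_nat /cell_res gez0_abs ?modz_ge0//.
by rewrite (lt_le_trans (ltz_mod _ mZ_neq0)).
Qed.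

Lemma cell_decomp x : exists z : int,
  x = q * (cell_frac x + (cell_res x)%:R + m%:R * z%:~R).
Proof.
exists (Num.floor (x / q) %/ m)%Z; rewrite /cell_frac.
have /(congr1 (fun i : int => i%:~R : R)) := divz_eq (Num.floor (x / q)) m.
rewrite intrD intrM => ->.
have -> : (Num.floor (x / q) %% m)%Z = (cell_res x)%:Z.
  by rewrite /cell_res gez0_abs// modz_ge0.
rewrite [X in q * X](_ : _ = x / q); last by ring.
by rewrite mulrC divfK.
Qed.

Lemma cell_eq x y (z : int) : x = y + q * z%:~R -> cell_frac x = cell_frac y.
Proof.
move=> ->; rewrite /cell_frac mulrDl mulrAC mulfV// mul1r.
by rewrite floorDrz ?intr_int// intrKfloor intrD; ring.
Qed.

Lemma cell_resD x y (z : int) : x = y + P * z%:~R ->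
  cell_frac x = cell_frac y /\ cell_res x = cell_res y.
Proof.
have qm : P = q * m%:R by rewrite /q divfK.
move=> xy; split; first by apply: (cell_eq (z := m%:Z * z)); rewrite xy qm intrM; ring.
rewrite /cell_res xy mulrDl qm.
have -> : q * m%:R * z%:~R / q = (z * m%:Z)%:~R by rewrite intrM; field.
by rewrite floorDrz ?intr_int// intrKfloor addrC modzMDl.
Qed.

Lemma cell_res_eq x y : cell_frac x = cell_frac y -> cell_res x = cell_res y ->
  exists z : int, x - y = P * z%:~R.
Proof.
have qm : P = q * m%:R by rewrite /q divfK.
move=> fxy rxy; have [z1 xE] := cell_decomp x; have [z2 yE] := cell_decomp y.
by exists (z1 - z2); rewrite xE yE fxy rxy qm intrB; ring.
Qed.

Definition cell_weight u (j : nat) : R := weight m ((u + j%:R) / m%:R).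

Lemma weight_cell x : weight m (x / P) = cell_weight (cell_frac x) (cell_res x).
Proof.
have [z xE] := cell_decomp x.
rewrite /cell_weight -(weightDint m _ (- z)) mulrNz; congr weight.
by rewrite {1}xE /q; field; rewrite mR_neq0 P_neq0.
Qed.

Lemma sum_cell_weight u : \sum_(j < m) cell_weight u j = 1.
Proof.
rewrite -(sum_weight (u / m%:R) m_gt0); apply: eq_bigr => j _.
by rewrite /cell_weight mulrDl.
Qed.

Definition selection Lam (sigma : R -> nat) : set R :=
  Lam `&` [set x | cell_res x = sigma (cell_frac x)].

(** A zero of the first factor is a multiple of [q] which is not a multiple of [P]; two points of
    a selection in the same coset have the same residue, so their difference is not such a zero. *)
Lemma selection_orthogonal Lam sigma :
  (forall x y, Lam x -> Lam y -> x != y -> T k (x - y) = 0) ->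
  forall x y, selection Lam sigma x -> selection Lam sigma y -> x != y ->
    T k.+1 (x - y) = 0.
Proof.
move=> oL x y [Lx sx] [Ly sy] xy; have := oL _ _ Lx Ly xy.
rewrite (tail_weightS hNM) => /eqP; rewrite mulf_eq0 => /orP[|/eqP//].
move=> /eqP /(weight_eq0 m_gt0)[z xyz nmz]; exfalso; apply: nmz.
have xyq : x = y + q * z%:~R.
  rewrite -[LHS](subrK y) addrC -[x - y](divfK P_neq0) -/P xyz /q.
  by field.
have fxy := cell_eq xyq.
have [z' xyP] := cell_res_eq fxy (etrans sx (etrans (congr1 sigma fxy) (esym sy))).
have E : q * z%:~R = P * z'%:~R by rewrite -xyP xyq addrAC subrr add0r.
suff : (m%:Z %| z)%Z by rewrite dvdzE absz_nat.
apply/dvdzP; exists z'; apply/eqP; rewrite -(eqr_int R) intrM; apply/eqP.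
by apply: (mulfI q_neq0); rewrite E /q; field.
Qed.

Lemma esum_orthogonal_le1 n Lam :
  (forall x y, Lam x -> Lam y -> x != y -> T n (x - y) = 0) ->
  (\esum_(x in Lam) (T n x)%:E <= 1)%E.
Proof.
move=> oL; apply: esum_le_seq => s us sL; apply: (bessel_tail_weight hNM) => //.
by move=> x y xs ys; apply: oL; exact: sL.
Qed.


Definition cell_sum Lam u (j : nat) : \bar R :=
  \esum_(x in Lam `&` [set x | cell_frac x = u /\ cell_res x = j]) (T k.+1 x)%:E.

Let tail0 n x : (0 <= (T n x)%:E)%E.
Proof. by rewrite lee_fin tail_weight_ge0. Qed.

Lemma cell_sum_ge0 Lam u j : (0 <= cell_sum Lam u j)%E.
Proof. by apply: esum_ge0 => x _; exact: tail0. Qed.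

Lemma cell_weight_gt0 Lam u j : generic_set Lam -> (cell_frac @` Lam) u ->
  0 < cell_weight u j.
Proof.
move=> gL [x Lx <-]; rewrite lt0r weight_ge0 andbT; apply/negP => /eqP.
move=> /(weight_eq0 m_gt0)[z E _]; have [z' xE] := cell_decomp x.
apply: (gL x k (z - j%:Z + (cell_res x)%:Z + m%:Z * z')) => //.
rewrite -[RHS]/(q * _) {1}xE; congr (_ * _).
have -> : cell_frac x = z%:~R - j%:R.
  by rewrite -[z%:~R](divfK mR_neq0) -E divfK// addrK.
by rewrite !intrD intrN intrM /=.
Qed.

Lemma esum_selection Lam sigma :
  \esum_(x in selection Lam sigma) (T k.+1 x)%:E =
  \esum_(u in cell_frac @` Lam) cell_sum Lam u (sigma u).
Proof.
rewrite (@esum_fibers _ _ _ _ (cell_frac @` Lam) cell_frac)//; last first.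
  by move=> x [Lx _]; exists x.
apply: eq_esum => u _; rewrite /cell_sum; congr esum.
apply/seteqP; split => x /=; first by move=> [[Lx ->] ->].
by move=> [Lx [<- e]]; split => //; split.
Qed.

Lemma esum_cells Lam : generic_set Lam ->
  \esum_(x in Lam) (T k x)%:E =
  \esum_(u in cell_frac @` Lam)
    (\sum_(j < m) (cell_weight u j)%:E * cell_sum Lam u j)%E.
Proof.
move=> gL; rewrite (@esum_fibers _ _ _ _ (cell_frac @` Lam) cell_frac)//.
apply: eq_esum => u Uu.
rewrite (eq_esum (b := fun x => \sum_(j < m)
    if x \in [set x | cell_res x = j] then (T k x)%:E else 0%E)); last first.
  move=> x _; rewrite (bigD1 (Ordinal (cell_res_lt x)))//= ifT ?inE//.
  rewrite big1 ?adde0// => j jx; rewrite ifF//; apply/negbTE/negP; rewrite inE/= => e.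
  by move: jx; rewrite -val_eqE/= e eqxx.
rewrite esum_sum; last by move=> x j _ _; case: ifP.
apply: eq_bigr => j _; rewrite -esum_mkcondr -esum_pZl; last 2 first.
- exact: cell_weight_gt0 gL Uu.
- by [].
rewrite (_ : _ `&` _ `&` _ = Lam `&` [set x | cell_frac x = u /\ cell_res x = j]).
  apply: eq_esum => x [_ [<- <-]]; rewrite -EFinM -weight_cell.
  by rewrite (tail_weightS hNM).
by apply/seteqP; split => x /=; [move=> [[? ?] ?]|move=> [? [? ?]]].
Qed.

(** Compare the given sum, an average over the residues in each coset with positive weights of
    total 1, with the selection of the residue of largest mass in each coset.  That selection has
    mass at most 1 by Bessel, so the average attains the maximum in every coset. *)
Lemma cell_sum_const Lam u (i j : 'I_m) : tail_spectrum k Lam ->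
  (cell_frac @` Lam) u -> cell_sum Lam u i = cell_sum Lam u j.
Proof.
move=> [oL gL sL] Uu.
pose U := cell_frac @` Lam.
pose best v : 'I_m := [arg max_(a > i) cell_sum Lam v a]%O.
have bestP v (a : 'I_m) : (cell_sum Lam v a <= cell_sum Lam v (best v))%E.
  by rewrite /best; case: arg_maxP => // b _; exact.
pose G v a := cell_sum Lam v a; pose Gm v := G v (best v).
pose t v := (\sum_(a < m) (cell_weight v a)%:E * G v a)%E.
have Gm1 : (\esum_(v in U) Gm v <= 1)%E.
  rewrite -(esum_selection Lam (fun v => best v)).
  by apply: esum_orthogonal_le1; exact: selection_orthogonal.
have t1 : \esum_(v in U) t v = 1%E by rewrite -esum_cells.
have Gm0 v : (0 <= Gm v)%E by exact: cell_sum_ge0.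
have t0 v : (0 <= t v)%E.
  by apply: sume_ge0 => a _; rewrite mule_ge0 ?lee_fin ?weight_ge0// cell_sum_ge0.
have tG v : (t v <= Gm v)%E.
  rewrite -[leRHS]mul1e -(sum_cell_weight v) -sumEFin ge0_sume_distrl; last first.
    by move=> a _; rewrite lee_fin weight_ge0.
  by apply: lee_sum => a _; rewrite lee_wpmul2l ?lee_fin ?weight_ge0//; exact: bestP.
have Uu1 : U `&` [set u] = [set u] by apply/setIidPr => _ ->.
move: t1 Gm1; rewrite (esumID [set u]) // Uu1 esum_set1//.
rewrite [X in (X <= 1)%E -> _](esumID [set u]) // Uu1 esum_set1//.
set r1 := esum _ t; set r2 := esum _ Gm => t1 G1.
have r12 : (r1 <= r2)%E by apply: le_esum => v _; exact: tG.
have r10 : (0 <= r1)%E by apply: esum_ge0 => v _; exact: t0.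
have Gmt : (Gm u <= t u)%E.
  have : (Gm u + r1 <= t u + r1)%E by rewrite t1 (le_trans _ G1)// leeD2l.
  rewrite leeD2rE// ge0_fin_numE// (@le_lt_trans _ _ 1%E) ?ltry// -t1.
  by rewrite leeDr.
have Gu1 : (Gm u <= 1)%E by rewrite (le_trans _ G1)// leeDl// (le_trans r10).
suff H (a : 'I_m) : G u a = Gm u by rewrite -/(G u i) -/(G u j) !H.
have Gfin (a' : 'I_m) : G u a' \is a fin_num.
  rewrite ge0_fin_numE; last exact: cell_sum_ge0.
  by rewrite (le_lt_trans (bestP u a'))// (le_lt_trans Gu1)// ltry.
pose g a' := fine (G u a').
have gE (a' : nat) : (a' < m)%N -> G u a' = (g a')%:E.
  by move=> a'm; rewrite /g fineK// (Gfin (Ordinal a'm)).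
have gm (a' : 'I_m) : g a' <= g (best u).
  by rewrite -lee_fin -!gE//; exact: bestP.
have : g (best u) <= \sum_(a' < m) cell_weight u a' * g a'.
  rewrite -lee_fin -gE// -sumEFin (le_trans Gmt)// /t le_eqVlt; apply/orP; left.
  by apply/eqP; apply: eq_bigr => a' _; rewrite gE.
rewrite -[X in X <= _]mul1r -(sum_cell_weight u) mulr_suml -subr_le0 -sumrB.
under eq_bigr do rewrite -mulrBr.
have h0 (a' : 'I_m) : true -> 0 <= cell_weight u a' * (g (best u) - g a').
  by move=> _; rewrite mulr_ge0 ?weight_ge0// subr_ge0.
move=> le0; have /eqP : \sum_(a' < m) cell_weight u a' * (g (best u) - g a') = 0.
  by apply/eqP; rewrite eq_le le0 sumr_ge0.
rewrite psumr_eq0// => /allP /(_ a (mem_index_enum _)) /=.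
rewrite mulf_eq0 (gt_eqF (cell_weight_gt0 a gL Uu))/= subr_eq0 => /eqP ge.
by rewrite /Gm !gE// ge.
Qed.

Lemma selection_spectrum Lam sigma : (forall u, (sigma u < m)%N) ->
  tail_spectrum k Lam -> tail_spectrum k.+1 (selection Lam sigma).
Proof.
move=> sm sL; have [oL gL s1] := sL; split.
- exact: selection_orthogonal.
- by move=> x j z [Lx _]; exact: gL.
rewrite esum_selection -s1 esum_cells//; apply: eq_esum => u Uu.
rewrite (eq_bigr (fun j : 'I_m => (cell_weight u j)%:E * cell_sum Lam u (sigma u))%E).
  rewrite -ge0_sume_distrl; last by move=> a _; rewrite lee_fin weight_ge0.
  by rewrite sumEFin sum_cell_weight mul1e.
by move=> j _; rewrite (cell_sum_const j (Ordinal (sm u)) sL Uu).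
Qed.

(** All residues of a coset have the same mass, and one of them has positive mass. *)
Lemma tail_spectrum_full Lam x (j : nat) : tail_spectrum k Lam -> Lam x ->
  exists y (z : int), Lam y /\ y = x + q * j%:R + P * z%:~R.
Proof.
move=> sL Lx; have [_ gL _] := sL; have [z1 xE] := cell_decomp x.
pose j' := ((cell_res x + j) %% m)%N; have j'm : (j' < m)%N by rewrite ltn_mod.
set u := cell_frac x.
have G0 : (0 < cell_sum Lam u j')%E.
  have Uu : (cell_frac @` Lam) u by exists x.
  rewrite (cell_sum_const (Ordinal j'm) (Ordinal (cell_res_lt x)) sL Uu).
  apply: (@lt_le_trans _ _ (T k.+1 x)%:E).
    by rewrite lte_fin; exact: generic_tail_weight_gt0 gL Lx.
  rewrite -(@esum_set1 _ _ x (fun x => (T k.+1 x)%:E))//.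
  rewrite /cell_sum esum_mkcond [leRHS]esum_mkcond; apply: le_esum => y _.
  case: ifPn; last by case: ifP.
  by rewrite inE => ->; rewrite ifT// inE.
have [[y [Ly [fy ry]]]|nex] := pselect (exists y, Lam y /\ cell_frac y = u /\ cell_res y = j').
  have [z2 yE] := cell_decomp y.
  exists y, (z2 - z1 - ((cell_res x + j) %/ m)%:Z); split => //.
  have qm : P = q * m%:R by rewrite /q divfK.
  have : (cell_res x)%:R + j%:R = ((cell_res x + j) %/ m)%:R * m%:R + j'%:R :> R.
    by rewrite -natrD -natrM -natrD -divn_eq.
  move=> e; rewrite yE [X in _ = X + _ + _]xE fy ry -/u !intrB qm /=.
  rewrite (_ : j'%:R = (cell_res x)%:R + j%:R - ((cell_res x + j) %/ m)%:R * m%:R); last first.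
    by rewrite e addrC addKr.
  by ring.
move: G0; rewrite /cell_sum (_ : _ `&` _ = set0) ?esum_set0 ?ltxx//.
by apply/seteqP; split => // y [Ly [fy ry]]; apply: nex; exists y.
Qed.

End selections.

(** * Spectrality implies divisibility *)

Section necessity.
Context {R : realType}.
Variables (N M : nat -> nat).
Hypothesis hNM : forall k, (1 <= k)%N -> (2 <= M k)%N /\ (M k <= N k)%N.
Implicit Types (Lam : set R) (x y u : R).

Lemma tail_spectrum_nonempty k Lam : tail_spectrum N M k Lam -> exists x, Lam x.
Proof.
move=> [_ _ s1]; apply/not_existsP => h; move: s1.
rewrite (_ : Lam = set0) ?esum_set0; first by move=> /eqP; rewrite eqe eq_sym oner_eq0.
by apply/seteqP; split => // x /h.
Qed.

Lemma tail_spectrum_dvd k Lam : tail_spectrum N M k Lam -> (M k.+2 %| N k.+2)%N.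
Proof.
move=> sL; apply/negPn/negP => ndvd.
have M1 : (1 < M k.+1)%N by have [] := @hNM k.+1 isT.
have M2 : (1 < M k.+2)%N by have [] := @hNM k.+2 isT.
have sL0 : tail_spectrum N M k.+1 (selection (R := R) N M k Lam (fun=> 0%N)).
  by apply: (selection_spectrum hNM) => // u; rewrite ltnW.
have [x0 Lx0] := tail_spectrum_nonempty sL0.
have [x1 [z1 [Lx1]]] := tail_spectrum_full hNM 1 sL0 Lx0.
have P0 : (scale N k.+1)%:R != 0 :> R by rewrite lt0r_neq0// (scaleR_gt0 hNM).
have m0 : (M k.+2)%:R != 0 :> R by rewrite pnatr_eq0 -lt0n ltnW.
set P : R := (scale N k.+1)%:R in P0 *.
have -> : (scale N k.+2)%:R = P * (N k.+2)%:R :> R by rewrite scaleS natrM.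
rewrite mulr1 => x1E.
have [fx|fx] := eqVneq (cell_frac N M k x1) (cell_frac N M k x0).
  have rx : cell_res N M k x1 = cell_res N M k x0 by rewrite Lx0.2 Lx1.2.
  have [z] := cell_res_eq hNM fx rx.
  rewrite x1E -/P => e; move/negP: ndvd; apply.
  have {}e : (N k.+2)%:R = (M k.+2)%:R * (z%:~R - (N k.+2)%:R * z1%:~R) :> R.
    apply: (mulfI P0); apply: (mulIf (invr_neq0 m0)).
    rewrite (_ : P * (_ * _) / _ = P * z%:~R - P * (N k.+2)%:R * z1%:~R); last by field.
    by rewrite -e; ring.
  have {}e : (N k.+2)%:Z = (z - (N k.+2)%:Z * z1) * (M k.+2)%:Z.
    by apply/eqP; rewrite -(eqr_int R) intrM intrB intrM -!pmulrn {1}e mulrC.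
  have : ((M k.+2)%:Z %| (N k.+2)%:Z)%Z by apply/dvdzP; exists (z - (N k.+2)%:Z * z1).
  by rewrite dvdzE !absz_nat.
(* the choice is modified in the coset of [x0] only, so that [x1] is still kept *)
pose sigma u := if u == cell_frac N M k x0 then 1%N else 0%N.
have sL1 : tail_spectrum N M k.+1 (selection (R := R) N M k Lam sigma).
  by apply: (selection_spectrum hNM) => // u; rewrite /sigma; case: ifP; rewrite // ltnW.
have Lx1' : selection N M k Lam sigma x1.
  by split; [exact: Lx1.1|rewrite /= /sigma (negbTE fx) Lx1.2].
(* adding the residue [M - 1] to that of [x1] leads back to the class of [x0] *)
have [x2 [z2 [Lx2]]] := tail_spectrum_full hNM (M k.+2).-1 sL1 Lx1'.
have -> : (scale N k.+2)%:R = P * (N k.+2)%:R :> R by rewrite scaleS natrM.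
have -> : (M k.+2).-1%:R = (M k.+2)%:R - 1 :> R by rewrite -subn1 natrB// ltnW.
rewrite x1E => x2E.
have {}x2E : x2 = x0 + P * ((N k.+2)%:Z * (1 + z1 + z2))%:~R.
  by rewrite x2E !(intrM, intrD) /=; field.
have [f2 r2] := cell_resD hNM x2E.
by have := Lx2.2; rewrite /= f2 r2 Lx0.2 /sigma eqxx.
Qed.

Lemma tail_spectrum_exists k Lam : tail_spectrum N M 0 Lam ->
  exists Lam', tail_spectrum (R := R) N M k Lam'.
Proof.
move=> s0; elim: k => [|k [L sL]]; first by exists Lam.
exists (selection N M k L (fun=> 0%N)); apply: (selection_spectrum hNM) => // u.
exact: (digits_gt0 hNM).
Qed.

Lemma countable_avoid (E : set R) : countable E -> exists x, ~ E x.
Proof.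
move=> cE; apply/existsNP => h.
have c01 : countable (`[0, 1]%classic : set R).
  by apply: sub_countable cE; apply: subset_card_le => x _; exact: h.
have := countable_lebesgue_measure0 c01.
by rewrite lebesgue_measure_itv/= lte01 sube0 => /eqP; rewrite onee_eq0.
Qed.

Variables (B : nat -> {fset R}) (mu : probability (measurableTypeR R) R).
Hypothesis hB : forall k, (1 <= k)%N -> B k = [fset j%:R | j in iota 0 (M k)]%fset.
Hypothesis hmu : is_infinite_convolution N B mu.

(** Countably many translations are excluded by genericity.  Density of the family, tested on one
    character, gives the Parseval identity. *)
Lemma spectral_tail_spectrum : spectral_measure mu ->
  exists Lam, tail_spectrum N M 0 Lam.
Proof.
move=> [Lam cLam [_ orth dense]].
have F x : sqn (fourier mu x) = tail_weight N M 0 x by exact: (sqn_fourier hNM hB hmu).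
have F0 x y : Lam x -> Lam y -> x != y -> fourier mu (y - x) = 0.
  by move=> Lx Ly xy; rewrite -dotL2_echar orth// (negbTE xy).
pose E := [set x | exists2 l, Lam l & exists (k : nat) (z : int),
   l - x = (scale N k.+1)%:R / (M k.+1)%:R * z%:~R].
have [xi nE] : exists xi, ~ E xi.
  apply: countable_avoid.
  have -> : E = \bigcup_(l in Lam) \bigcup_(k in [set: nat]) \bigcup_(z in [set: int])
      [set l - (scale N k.+1)%:R / (M k.+1)%:R * z%:~R].
    apply/seteqP; split => x.
      move=> [l Ll [k [z e]]]; exists l => //; exists k => //; exists z => //=.
      by rewrite -e; ring.
    by move=> [l Ll [k _ [z _ /= ->]]]; exists l => //; exists k, z; ring.
  apply: bigcup_countable => // l _; apply: bigcup_countable => // k _.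
  by apply: bigcup_countable => // z _; exact: countable1.
exists [set l - xi | l in Lam].
have oL x y : [set l - xi | l in Lam] x -> [set l - xi | l in Lam] y -> x != y ->
    tail_weight N M 0 (x - y) = 0.
  move=> [l Ll <-] [l' Ll' <-] ll'; rewrite -F (_ : _ - _ = l - l'); last by ring.
  rewrite F0//; first by apply/eqP; rewrite sqn_eq0.
  by apply: contra ll' => /eqP ->.
split => //.
  by move=> _ k z [l Ll <-] e; apply: nE; exists l => //; exists k, z.
apply/eqP; rewrite eq_le esum_orthogonal_le1//=; apply/lee_addgt0Pr => e e0.
have e1 : 0 < Num.sqrt e by rewrite sqrtr_gt0.
have [s [c [sL]]] := dense _ (inL2_echar mu xi) _ e1.
rewrite (normL2_lt _ _ e1) (sqr_sqrtr (ltW e0)).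
rewrite (_ : energy mu _ = energy mu (fun t =>
    echar (- (xi * t)) - \sum_(x <- s) c x * echar (- (x * t)))); last first.
  congr energy; apply/funext => t; rewrite expi_echar; congr (_ - _).
  by apply: eq_bigr => i _; rewrite expi_echar.
rewrite energy_echar_sub ?fset_uniq//; last first.
  by move=> x y xs ys xy; rewrite F0 1?eq_sym//; exact: sL.
rewrite lte_fin => lt_e.
have us : uniq [seq l - xi | l <- s] by rewrite map_inj_uniq ?fset_uniq// => x y /addIr.
have S1 : \sum_(x <- [seq l - xi | l <- s]) tail_weight N M 0 x =
    \sum_(x <- s) sqn (fourier mu (x - xi)).
  by rewrite big_map; apply: eq_bigr => l _; rewrite F.
have := @esum_ge_seq _ _ [set l - xi | l in Lam] (tail_weight N M 0) _ us.
move=> /(_ _ (tail_weight_ge0 hNM 0)) h.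
apply: (@le_trans _ _ ((\sum_(x <- s) sqn (fourier mu (x - xi)))%:E + e%:E)%E).
  rewrite -EFinD lee_fin; have : 0 <= \sum_(x <- s) sqn (c x - fourier mu (x - xi)).
    by apply: sumr_ge0 => x _; exact: sqn_ge0.
  lra.
rewrite leeD2r// -S1; apply: h => _ /mapP[l ls ->]; exists l => //.
exact: sL.
Qed.

Lemma spectral_dvd : spectral_measure mu -> forall k, (2 <= k)%N -> (M k %| N k)%N.
Proof.
move=> /spectral_tail_spectrum[Lam sL] [|[|k]]// _.
by have [L'] := tail_spectrum_exists k sL; exact: tail_spectrum_dvd.
Qed.

End necessity.

Theorem theorem2p2 (R : realType) (N M : nat -> nat) (B : nat -> {fset R})
    (hNM : forall k, (1 <= k)%N -> (2 <= M k)%N /\ (M k <= N k)%N)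
    (hB : forall k, (1 <= k)%N -> B k = [fset j%:R | j in iota 0 (M k)]%fset)
    (mu : probability (measurableTypeR R) R)
    (hmu : is_infinite_convolution N B mu) :
  spectral_measure mu <-> (forall k, (2 <= k)%N -> (M k %| N k)%N).
Proof.
split; first exact: (spectral_dvd hNM hB hmu).
by move=> hdvd; exact: (dvd_spectral hNM hdvd hB hmu).
Qed.
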